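(* Enumerating the transitive triples of $d$-cycles with product $1$ in $\mathfrak{S}_d$, up to simultaneous conjugation, gives the following complete classification, up to isomorphism, of the Belyi maps $t\colon X\to\mathbb{P}^1$ of degree $d=2g+1$ on curves $X$ of genus $g$ (called extremal maps), for $g=1,2,3$. For $g=1$, $d=3$: there is exactly $1$ extremal map, with monodromy group $\mathbb{Z}/3$ (all cyclic). For $g=2$, $d=5$: there are exactly $4$ extremal maps, of which $3$ have monodromy group $\mathbb{Z}/5$ and $1$ has monodromy group $A_5$ (the first non-cyclic example). For $g=3$, $d=7$: there are exactly $30$ extremal maps, of which $5$ have monodromy group $\mathbb{Z}/7$, $2$ have monodromy group $\mathrm{PSL}_2(\mathbb{F}_7)$, and $23$ have monodromy group $A_7$. In particular: (i) the cyclic counts $1,3,5$ (for $d=3,5,7$) agree with the number $\prod_{p^k\| d}p^{k-1}(p-2)$ of Belyi maps of odd degree $d\geq 3$ with passport $\langle(d),(d),(d)\rangle$ and cyclic monodromy group $\mathbb{Z}/d$; (ii) extremal Belyi maps need not be cyclic: in genus $2$ there is exactly one non-cyclic extremal map, of degree $5$ with monodromy group $A_5$; (iii) in genus $3$ the extremal maps realize exactly three monodromy groups, and two of them (two of the extremal maps) have the Klein group $\mathrm{PSL}_2(\mathbb{F}_7)$ of order $168$ as monodromy, acting on $7$ letters as on $\mathbb{P}^1(\mathbb{F}_7)$.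
   Context: A Belyi map is a non-constant morphism $t\colon X\to\mathbb{P}^1$ from a smooth projective connected curve over $\mathbb{C}$ with all branch points in $\{0,1,\infty\}$; isomorphisms are isomorphisms of the source curves commuting with the maps to $\mathbb{P}^1$. Isomorphism classes of degree-$d$ Belyi maps correspond bijectively to transitive triples $(\sigma_0,\sigma_1,\sigma_\infty)\in\mathfrak{S}_d^3$ (where $\mathfrak{S}_d$ is the symmetric group on $d$ letters) with $\sigma_0\sigma_1\sigma_\infty=1$, modulo simultaneous conjugation; the cycle lengths of $\sigma_s$ are the ramification indices over $s$, and the monodromy group is $\langle\sigma_0,\sigma_1\rangle$. A map is called cyclic if its monodromy group is cyclic. The passport is the triple of cycle types of $\sigma_0,\sigma_1,\sigma_\infty$. Every Belyi map of degree $d$ on a curve of genus $g$ satisfies $d\ge 2g+1$, and those with $d=2g+1$ are exactly those for which $\sigma_0,\sigma_1,\sigma_\infty$ are all $d$-cycles. The notation $p^k\| d$ means that $p^k$ is the exact power of the prime $p$ dividing $d$.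
   Formalization: The clause ''acting on 7 letters as on P^1(F_7)'' is impossible, since P^1(F_7) has 8 points; it is replaced by: the monodromy group acts on the 7 letters as GL_3(F_2) = PSL_3(F_2), which is isomorphic to PSL_2(F_7), acts on the 7 points of P^2(F_2). *)

(* Defs.v *)
From mathcomp Require Import all_boot all_order all_fingroup all_algebra all_solvable.

Set Implicit Arguments.
Unset Strict Implicit.
Unset Printing Implicit Defensive.

Import GroupScope.

(* A degree-[d] Belyi map is encoded by its monodromy triple               *)
(* (sigma_0, sigma_1, sigma_oo); isomorphisms of Belyi maps become         *)
(* simultaneous conjugations ([belyi_iso]).  Permutations compose from     *)
(* left to right in MathComp.                                              *)
Notation perm_triple d := ({perm 'I_d} * {perm 'I_d} * {perm 'I_d})%type.

Definition sigma0 d (t : perm_triple d) : {perm 'I_d} := t.1.1.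
Definition sigma1 d (t : perm_triple d) : {perm 'I_d} := t.1.2.
Definition sigmaoo d (t : perm_triple d) : {perm 'I_d} := t.2.

Definition monodromy d (t : perm_triple d) : {group {perm 'I_d}} :=
  <<[set sigma0 t; sigma1 t]>>%G.

Definition is_belyi d (t : perm_triple d) : bool :=
  [transitive monodromy t, on [set: 'I_d] | 'P]
  && (sigma0 t * sigma1 t * sigmaoo t == 1).

Definition conj_triple d (t : perm_triple d) (s : {perm 'I_d}) :
    perm_triple d :=
  (sigma0 t ^ s, sigma1 t ^ s, sigmaoo t ^ s).

Definition belyi_iso d : rel (perm_triple d) :=
  fun t u => [exists s : {perm 'I_d}, conj_triple t s == u].

Definition iso_classes d (D : {set perm_triple d}) :
    {set {set perm_triple d}} :=
  equivalence_partition (@belyi_iso d) D.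

(* [porbits s] is the set of supports of the cycles of [s], fixed points   *)
(* included; the points over a branch point are the cycles of the          *)
(* corresponding permutation and [#|O|] is the ramification index.         *)
Definition ramification d (s : {perm 'I_d}) : nat :=
  (\sum_(O in porbits s) #|O|.-1)%N.

(* Riemann-Hurwitz, 2 g - 2 = - 2 d + \sum_P (e_P - 1), without subtraction. *)
Definition has_genus d (t : perm_triple d) (g : nat) : bool :=
  (g.*2 + d.*2 == 2 + (ramification (sigma0 t) + ramification (sigma1 t)
                       + ramification (sigmaoo t)))%N.

Definition cycle_type d (s : {perm 'I_d}) : seq nat :=
  sort geq (map (fun O : {set 'I_d} => #|O|) (enum (porbits s))).

Definition passport d (t : perm_triple d) : seq nat * seq nat * seq nat :=
  (cycle_type (sigma0 t), cycle_type (sigma1 t), cycle_type (sigmaoo t)).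

Definition cyclic_map d (t : perm_triple d) : bool := cyclic (monodromy t).

Definition extremal_maps (g : nat) : {set perm_triple g.*2.+1} :=
  [set t | is_belyi t && has_genus t g].

(* For odd [d] every prime [p] dividing [d] is at least 3, so that [p - 2] *)
(* does not truncate.                                                      *)
Definition prod_formula (d : nat) : nat :=
  (\prod_(p <- primes d) (p ^ (logn p d).-1 * (p - 2)))%N.

Section ProjectiveGroups.
Variables (n : nat) (F : finFieldType).

Definition SL : {set {'GL_n[F]}} := [set g | (\det (GLval g) == 1)%R].

Lemma SL_group_set : group_set SL.
Proof.
apply/group_setP; split=> [|u v]; first by rewrite inE GL_1E det1.
by rewrite !inE GL_MxE det_mulmx => /eqP-> /eqP->; rewrite GRing.mulr1.
Qed.
Canonical SL_group : {group {'GL_n[F]}} := Group SL_group_set.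

Definition PSL : {set coset_of 'Z(SL)} := SL / 'Z(SL).
Canonical PSL_group : {group coset_of 'Z(SL)} := [group of PSL].

End ProjectiveGroups.

Definition line (F : finFieldType) n (u : 'rV[F]_n) : {set 'rV[F]_n} :=
  [set (a *: u)%R | a : F].

(* The points of P^(n-1)(F), as the lines through 0 in F^n. *)
Definition proj_points (F : finFieldType) n : {set {set 'rV[F]_n}} :=
  [set line u | u : 'rV[F]_n & u != 0%R].

(* A permutation group on 7 letters which, up to relabelling the letters,  *)
(* is the image of GL_3(F_2) (= PSL_3(F_2)) in the symmetric group of      *)
(* the 7 points of P^2(F_2).                                               *)
Definition acts_as_on_Fano_plane (G : {set {perm 'I_7}}) : Prop :=
  exists2 f : 'I_7 -> {set 'rV['F_2]_3},
    injective f /\ f @: [set: 'I_7] = proj_points 'F_2 3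
  & forall s : {perm 'I_7},
      s \in G <->
      exists g : {'GL_3['F_2]},
        forall x : 'I_7, f (s x) = [set (v *m GLval g)%R | v in f x].

(* Main.v *)
(* By Riemann-Hurwitz the extremal maps are the triples of full cycles.  Up to
   conjugation sigma_0 is the rotation c : i -> i + 1 of Z/d, whose centraliser
   is <c>, so the classes are the <c>-orbits on the full cycles s such that
   c s is a full cycle; for d = 3, 5, 7 these orbits are enumerated.

   - Cyclic monodromy means s = c^a with a and a + 1 both prime to d, and such
     a are counted by the Chinese remainder theorem.
   - For d prime, a group of even permutations containing c and c^tau for some
     transposition tau is the alternating group.
   - SL_2(F_7) permutes the seven splittings
       { oo, i + squares }  |  { i, i + non-squares }
     of P^1(F_7), and the transvection x -> x + 1 acts on them as c.  The two
     remaining classes for d = 7 come from this action and its mirror image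
     under i -> - i.  The image preserves a Fano plane and has at least 168
     elements, which pins down both the image and the kernel. *)

Require Import Defs.
From mathcomp Require Import all_boot all_order all_fingroup all_algebra all_solvable.
From mathcomp Require Import ring finfield.

Set Implicit Arguments.
Unset Strict Implicit.
Unset Printing Implicit Defensive.

(** * Pairs of consecutive units *)

Section UnitPairs.

(** Both [a] and [a + 1] are prime to [d]: for [c] the rotation of [d] letters, [c ^+ a] and
    [c * c ^+ a] are then full cycles. *)
Definition unit_pair (d a : nat) : bool := coprime d (a * a.+1).

Definition unit_pairs (d : nat) : seq nat := filter (unit_pair d) (iota 0 d).

Lemma unit_pair_modn d m a : m %| d -> unit_pair m (a %% d) = unit_pair m a.
Proof.
move=> mod; have pairE b : b * b.+1 = (b %% m) * (b %% m).+1 %[mod m].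
  by rewrite modnMml -[RHS]modnMmr -[(b %% m).+1]addn1 modnDml addn1 modnMmr.
by rewrite /unit_pair -coprime_modr pairE modn_dvdm // -pairE coprime_modr.
Qed.

Lemma count_iota_modn (P : pred nat) m k :
  count (fun a => P (a %% m)) (iota 0 (k * m)) = k * count P (iota 0 m).
Proof.
elim: k => // k IHk; rewrite mulSnr iotaD count_cat IHk mulSnr; congr (_ + _).
rewrite -[X in iota X]addn0 iotaDl count_map; apply: eq_in_count => a.
by rewrite mem_iota => /= lta; rewrite modnMDl modn_small.
Qed.

(** Coprimality to [p ^ e] depends only on the residue modulo [p], and each residue occurs
    [p ^ e.-1] times. Exactly the two residues 0 and [p - 1] are excluded. *)
Lemma unit_pairs_pfactor p e : prime p -> 0 < e ->
  size (unit_pairs (p ^ e)) = p ^ e.-1 * (p - 2).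
Proof.
move=> p_pr; case: e => // e _; rewrite size_filter expnSr.
transitivity (count (fun a => unit_pair p (a %% p)) (iota 0 (p ^ e * p))).
  by apply: eq_count => a; rewrite unit_pair_modn // /unit_pair -expnSr coprime_pexpl.
rewrite count_iota_modn /=; congr (_ * _).
have [m def_p] : exists m, p = m.+2 by exists p.-2; case: p p_pr => [|[]].
have -> : iota 0 p = 0 :: iota 1 m ++ [:: m.+1].
  by rewrite def_p -(addn1 m.+1) iotaD.
have p0 : unit_pair p 0 = false.
  by rewrite /unit_pair mul0n -coprime_modr mod0n /coprime gcdn0 def_p.
have p1 : unit_pair p m.+1 = false.
  by rewrite /unit_pair -def_p prime_coprime // dvdn_mull.
rewrite /= count_cat /= p0 p1 !addn0 add0n (_ : p - 2 = size (iota 1 m)); last first.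
  by rewrite size_iota def_p subn2.
apply/eqP; rewrite -all_count; apply/allP=> a; rewrite mem_iota add1n => /andP[a0 lta].
by rewrite /unit_pair coprimeMr !prime_coprime // !gtnNdvd // def_p ltnS // ltnW.
Qed.

(** Chinese remainder theorem: reduction modulo [m] and [n] is the bijection [h], and the condition
    modulo [m * n] splits into the two conditions modulo [m] and [n]. *)
Lemma unit_pairs_coprime m n : 0 < m -> 0 < n -> coprime m n ->
  size (unit_pairs (m * n)) = size (unit_pairs m) * size (unit_pairs n).
Proof.
move=> m0 n0 co_mn.
have sizeE d : size (unit_pairs d) = #|[set a : 'I_d | unit_pair d a]|.
  rewrite size_filter -sum1_count -sum1_card -[d in iota 0 d]subn0 big_mkord.
  by apply: eq_bigl => a; rewrite inE.
rewrite !sizeE -cardsX.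
pose h (a : 'I_(m * n)) := (Ordinal (ltn_pmod a m0), Ordinal (ltn_pmod a n0)).
have h_inj : injective h.
  move=> a b /eqP; rewrite xpair_eqE -!val_eqE /= -chinese_remainder // !modn_small // => /eqP.
  exact: val_inj.
have h_bij : bijective h by apply: inj_card_bij h_inj _; rewrite card_prod !card_ord.
rewrite -(on_card_preimset (f := h)); last exact: onW_bij.
by apply: eq_card => a; rewrite !inE /= !unit_pair_modn // /unit_pair coprimeMl.
Qed.

Lemma prod_formula_coprime m n : 0 < m -> 0 < n -> coprime m n ->
  prod_formula (m * n) = prod_formula m * prod_formula n.
Proof.
move=> m0 n0 co_mn; rewrite /prod_formula.
have /(perm_big _) -> : perm_eq (primes (m * n)) (primes m ++ primes n).
  apply: uniq_perm => [||p]; first exact: primes_uniq.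
    by rewrite cat_uniq !primes_uniq -coprime_has_primes // co_mn.
  by rewrite mem_cat primesM.
rewrite big_cat /= !big_seq; congr (_ * _); apply: eq_bigr => p;
  rewrite mem_primes => /and3P[p_pr _ p_dv]; rewrite lognM //.
  by rewrite (@logn_coprime p n) ?addn0 // (coprime_dvdl p_dv).
by rewrite (@logn_coprime p m) // (coprime_dvdl p_dv) // coprime_sym.
Qed.

Lemma prod_formula_pfactor p e : prime p -> 0 < e ->
  prod_formula (p ^ e) = p ^ e.-1 * (p - 2).
Proof.
by move=> p_pr e0; rewrite /prod_formula primesX // primes_prime // big_seq1 pfactorK.
Qed.

(** Both sides are multiplicative, so strong induction splits off the full power of the least prime
    factor of [d]. *)
Lemma size_unit_pairs d : 0 < d -> size (unit_pairs d) = prod_formula d.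
Proof.
elim/ltn_ind: d => d IHd d0; have [d1 | ] := leqP d 1.
  (* Modulo 1 the single residue 0 counts, and the product over primes is empty: both sides are
     1. *)
  have -> : d = 1 by apply/eqP; rewrite eqn_leq d1.
  by rewrite /prod_formula big_nil.
move=> d_gt1; pose p := pdiv d; have p_pr : prime p by apply: pdiv_prime.
have e_gt0 : 0 < logn p d by rewrite logn_gt0 mem_primes p_pr d0 pdiv_dvd.
have [m co_pm def_d] := pfactor_coprime p_pr d0.
have m0 : 0 < m by move: d0; rewrite def_d muln_gt0 => /andP[].
have co_mp : coprime m (p ^ logn p d) by rewrite coprime_sym coprimeXl.
have pe0 : 0 < p ^ logn p d by rewrite expn_gt0 prime_gt0.
rewrite [in LHS]def_d [in RHS]def_d unit_pairs_coprime // prod_formula_coprime //.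
rewrite unit_pairs_pfactor // prod_formula_pfactor // IHd //.
rewrite [X in _ < X]def_d -[X in X < _]muln1 ltn_pmul2l //.
by rewrite -(exp1n (logn p d)) ltn_exp2r ?prime_gt1.
Qed.

End UnitPairs.

Import GroupScope.

(** * Full cycles and classes of triples *)

(** The map from an element to its class in [D] is a bijection from [r] onto the partition:
    separation gives injectivity, covering gives surjectivity. *)
Lemma card_partition_reps (T : finType) (R : rel T) (D : {set T}) (r : seq T) :
    {in D & &, equivalence_rel R} -> uniq r -> {subset r <= D} ->
    {in D, forall x, has (R x) r} -> {in r &, forall x y, R x y -> x = y} ->
  #|equivalence_partition R D| = size r.
Proof.
move=> eqR r_uniq rD r_cover r_sep.
pose cls x := [set y in D | R x y].
have Rxx x : x \in D -> R x x by move=> Dx; have [] := eqR x x x Dx Dx Dx.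
have cls_inj : {in r &, injective cls}.
  move=> x y rx ry eq_cls; apply: r_sep => //.
  have : y \in cls y by rewrite inE rD ?Rxx ?rD.
  by rewrite -eq_cls inE => /andP[].
rewrite -(card_uniqP r_uniq) -(card_in_imset cls_inj).
apply: eq_card => A; apply/imsetP/imsetP=> -[x Dx ->]; last by exists x; rewrite ?rD.
have /hasP[y ry Rxy] := r_cover x Dx; exists y => //.
apply/setP=> z; rewrite !inE; case: (boolP (z \in D)) => //= Dz.
by have [_ /(_ Rxy)] := eqR x y z Dx (rD y ry) Dz.
Qed.

Section FullCycles.
Variable n : nat.
Implicit Types s w : {perm 'I_n.+1}.

Definition full_cycle s := porbit s ord0 == [set: 'I_n.+1].

Lemma full_cycleP s : reflect (#|porbits s| = 1%N) (full_cycle s).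
Proof.
apply: (iffP eqP) => [s0 | s1].
  suff -> : porbits s = [set porbit s ord0] by rewrite cards1.
  apply/setP=> O; rewrite inE; apply/imsetP/eqP => [[x _ ->]|->]; last by exists ord0.
  by apply/eqP; rewrite eq_porbit_mem s0 inE.
have/eqP/cards1P[O sO] := s1.
have porbitO x : porbit s x = O.
  by have : porbit s x \in porbits s; [apply: imset_f | rewrite sO inE => /eqP].
by apply/setP=> x; rewrite inE -eq_porbit_mem !porbitO eqxx.
Qed.

(** A test on the first [n + 1] iterates of 0, suited to evaluation on sequences. *)
Lemma full_cycle_uniq s : full_cycle s = uniq (traject s ord0 n.+1).
Proof.
apply/eqP/idP => [s0 | Us].
  by have := uniq_traject_porbit s ord0; rewrite s0 cardsT card_ord.
apply/eqP; rewrite eqEcard subsetT cardsT card_ord /=.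
rewrite -{1}(size_traject s ord0 n.+1) -(card_uniqP Us); apply/subset_leq_card/subsetP=> x.
by case/trajectP=> k _ ->; rewrite -permX mem_porbit.
Qed.

Lemma full_cycle_transitive s (G : {group {perm 'I_n.+1}}) :
  full_cycle s -> s \in G -> [transitive G, on [set: 'I_n.+1] | 'P].
Proof.
move=> /eqP s0 Gs; apply/imsetP; exists ord0 => //; apply/esym/setP=> x.
rewrite inE; have: x \in porbit s ord0 by rewrite s0.
by case/porbitP=> k ->; apply/orbitP; exists (s ^+ k); rewrite ?groupX.
Qed.

Lemma full_cycleJ s w : full_cycle (s ^ w) = full_cycle s.
Proof.
wlog suff: s w / full_cycle s -> full_cycle (s ^ w) => [IH|].
  by apply/idP/idP => [/(IH _ w^-1)|/IH//]; rewrite conjgK.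
move=> /eqP s0; have orb x y : exists k, y = (s ^+ k) x.
  by apply/porbitP; rewrite -eq_porbit_mem; apply/eqP; transitivity (porbit s ord0);
    [|apply/esym]; apply/eqP; rewrite eq_porbit_mem s0 inE.
apply/eqP/setP=> x; rewrite inE; have [k def_x] := orb (w^-1 ord0) (w^-1 x).
apply/porbitP; exists k; apply: (@perm_inj _ w^-1); rewrite def_x -conjXg.
by rewrite -{2}[ord0](permKV w) permJ permK.
Qed.

Lemma full_cycleV s : full_cycle s^-1 = full_cycle s.
Proof. by rewrite /full_cycle porbitV. Qed.

Lemma full_cycle_expg s : full_cycle s -> s ^+ n.+1 = 1.
Proof.
move=> /eqP s0; apply/permP=> x; rewrite perm1.
have: x \in porbit s ord0 by rewrite s0.
case/porbitP=> k ->; rewrite -!permM -expgD addnC expgD permM; congr (_ _).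
by have := iter_porbit s ord0; rewrite s0 cardsT card_ord -permX.
Qed.

Lemma full_cycle_odd s : full_cycle s -> odd_perm s = ~~ odd n.+1.
Proof. by move/full_cycleP=> s1; rewrite /odd_perm s1 card_ord addbT. Qed.

(** The cycle lengths add up to [n + 1], so the ramification is [n + 1] minus the number of cycles,
    and there is at least one cycle. *)
Lemma ramification_leq s : ramification s <= n ?= iff full_cycle s.
Proof.
have ramE : (ramification s + #|porbits s| = n.+1)%N.
  rewrite -[RHS]card_ord -cardsT.
  have trans_s : {in [set: 'I_n.+1] & &, equivalence_rel (fun x y => y \in porbit s x)}.
    move=> x y z _ _ _; split=> [|]; first exact: porbit_id.
    by rewrite -eq_porbit_mem eq_sym => /eqP; rewrite ![z \in _]porbit_sym -!eq_porbit_mem => ->.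
  have /card_partition -> := equivalence_partitionP trans_s.
  rewrite (_ : equivalence_partition _ _ = porbits s); last first.
    apply/setP=> O; apply/imsetP/imsetP=> -[x _ ->]; exists x => //;
    by apply/setP=> y; rewrite !inE.
  rewrite /ramification -sum1_card -big_split /=; apply: eq_bigr => O /imsetP[x _ ->].
  by rewrite addn1 prednK // lt0n card_porbit_neq0.
have pos : 0 < #|porbits s| by apply/card_gt0P; exists (porbit s ord0); apply: imset_f.
apply/leqifP; case: full_cycleP => [s1 | /eqP s1].
  by apply/eqP; move: ramE; rewrite s1 addn1 => -[].
rewrite -ltnS; apply: leq_trans (eq_leq ramE).
by rewrite -addn2 leq_add2l ltn_neqAle eq_sym s1.
Qed.

Definition rot_perm : {perm 'I_n.+1} := perm (@ordS_inj n.+1).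

Lemma rot_permX k (i : 'I_n.+1) : (rot_perm ^+ k) i = ((i + k) %% n.+1)%N :> nat.
Proof.
elim: k => [|k IHk]; first by rewrite perm1 addn0 modn_small.
by rewrite expgSr permM permE /= IHk addnS -addn1 modnDml addn1.
Qed.

Lemma full_cycle_rot : full_cycle rot_perm.
Proof.
apply/eqP/setP=> x; rewrite inE; apply/porbitP; exists x; apply: val_inj.
by rewrite /= rot_permX add0n modn_small.
Qed.

Lemma order_rot_perm : #[rot_perm] = n.+1.
Proof.
apply/eqP; rewrite eqn_dvd order_dvdn full_cycle_expg ?full_cycle_rot //=.
have /(congr1 (fun s : {perm 'I_n.+1} => val (s ord0))) := expg_order rot_perm.
by rewrite /= rot_permX perm1 add0n => e0; rewrite /dvdn e0 eqxx.
Qed.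

Lemma full_cycle_rotX k : full_cycle (rot_perm ^+ k) = coprime n.+1 k.
Proof.
apply/idP/idP => [/eqP r0 | co_nk].
  (* [inord 1] has value 1 only if [n > 0]. *)
  have [->|n0] := posnP n; first by rewrite coprime1n.
  have: inord 1 \in porbit (rot_perm ^+ k) ord0 by rewrite r0 inE.
  case/porbitP=> m /(congr1 val); rewrite -expgM /= rot_permX inordK // add0n => e1.
  rewrite /coprime -dvdn1 [X in _ %| X]e1 /dvdn modn_dvdm ?dvdn_gcdl //.
  by rewrite -/(dvdn _ _) dvdn_mulr ?dvdn_gcdr.
have : rot_perm \in <[rot_perm ^+ k]>.
  have: generator <[rot_perm]> (rot_perm ^+ k) by rewrite generator_coprime order_rot_perm.
  by move=> /eqP<-; apply: cycle_id.
case/cycleP=> m def_r; apply/eqP/setP=> x; rewrite inE; apply/porbitP.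
exists (m * x)%N; apply: val_inj; rewrite expgM -def_r /= rot_permX add0n modn_small //.
Qed.

(** The conjugating permutation is [i -> s^i(0)], which carries [i -> i + 1] to [s]. *)
Lemma full_cycle_conj s : full_cycle s -> exists w, rot_perm ^ w = s.
Proof.
move=> s0; have Us : uniq (traject s ord0 n.+1) by rewrite -full_cycle_uniq.
have w_inj : injective (fun i : 'I_n.+1 => (s ^+ i) ord0).
  move=> i j; rewrite !permX => eq_ij.
  apply: val_inj; apply/eqP; rewrite -(nth_uniq ord0 _ _ Us) ?size_traject ?ltn_ord //.
  by rewrite !nth_traject ?ltn_ord //; apply/eqP.
exists (perm w_inj); apply/permP=> x; rewrite -{1}(permKV (perm w_inj) x) permJ.
set i := _ x; rewrite -[x in RHS](permKV (perm w_inj)) -/i !permE /=.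
rewrite -permM -expgSr; have := ltn_ord i; rewrite ltnS leq_eqVlt => /orP[/eqP i_n|lt_in].
  (* At the last letter the rotation wraps around to 0, matched by [s ^+ n.+1 = 1]. *)
  by rewrite i_n modnn expg0 full_cycle_expg.
by rewrite modn_small.
Qed.

(** A permutation commuting with a full cycle is determined by the image of 0, so the exponent is
    [w ord0]. *)
Lemma cent_rot_perm w : commute rot_perm w -> exists2 k, k < n.+1 & w = rot_perm ^+ k.
Proof.
move=> cw; exists (w ord0) => //; apply/permP=> i; apply: val_inj.
have -> : i = (rot_perm ^+ i) ord0.
  by apply: val_inj; rewrite /= rot_permX add0n modn_small.
rewrite -!permM -expgD -(commuteX i (commute_sym cw)) addnC expgD !permM /=.
by rewrite !rot_permX add0n modnDml.
Qed.

End FullCycles.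

Lemma belyi_iso_equivalence d (D : {set perm_triple d}) :
  {in D & &, equivalence_rel (@belyi_iso d)}.
Proof.
have trans (t u v : perm_triple d) : belyi_iso t u -> belyi_iso u v -> belyi_iso t v.
  move=> /existsP[a /eqP<-] /existsP[b /eqP<-]; apply/existsP; exists (a * b).
  by rewrite /conj_triple /sigma0 /sigma1 /sigmaoo /= !conjgM.
have sym (t u : perm_triple d) : belyi_iso t u -> belyi_iso u t.
  case: t => [[a b] c] /existsP[w /eqP<-]; apply/existsP; exists w^-1.
  by rewrite /conj_triple /sigma0 /sigma1 /sigmaoo /= !conjgK.
move=> t u v _ _ _; split=> [|tu].
  case: v => [[a b] c]; apply/existsP; exists 1; apply/eqP.
  by rewrite /conj_triple /sigma0 /sigma1 /sigmaoo /= !conjg1.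
by apply/idP/idP; apply: trans => //; apply: sym.
Qed.

Lemma monodromyJ d (t : perm_triple d) w :
  monodromy (conj_triple t w) :=: monodromy t :^ w.
Proof. by rewrite /= -genJ conjUg !conjg_set1. Qed.

Definition conj_invariant d (P : pred (perm_triple d)) :=
  forall t w, P (conj_triple t w) = P t.

Lemma isog_monodromy_invariant d (gT : finGroupType) (G : {group gT}) :
  conj_invariant (fun t : perm_triple d => monodromy t \isog G).
Proof.
move=> t w; rewrite monodromyJ; apply/idP/idP.
  exact: isog_trans (conj_isog _ _).
by apply: isog_trans; rewrite isog_sym conj_isog.
Qed.

Lemma Alt_monodromy_invariant d :
  conj_invariant (fun t : perm_triple d => monodromy t :==: 'Alt_('I_d)).
Proof.
move=> t w; have /normP {1}<- : w \in 'N('Alt_('I_d)).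
  by rewrite (subsetP (Alt_norm _)) ?inE.
by rewrite monodromyJ (inj_eq (@conjsg_inj _ w)).
Qed.

(** * Normal form of triples of full cycles *)

Section Triples.
Variable n : nat.
Implicit Types (s w : {perm 'I_n.+1}) (t : perm_triple n.+1).
Local Notation rot_perm := (rot_perm n).

Definition full_triples : {set perm_triple n.+1} :=
  [set t | [&& full_cycle (sigma0 t), full_cycle (sigma1 t), full_cycle (sigmaoo t)
             & sigma0 t * sigma1 t * sigmaoo t == 1]].

(** Normal form with the rotation as first entry; the product relation forces the third entry. *)
Definition std_triple s : perm_triple n.+1 := (rot_perm, s, (rot_perm * s)^-1).

Lemma full_triples_belyi t : t \in full_triples -> is_belyi t.
Proof.
rewrite inE => /and4P[t0 _ _ t1]; rewrite /is_belyi t1 andbT.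
by apply: (full_cycle_transitive t0); rewrite mem_gen // !inE eqxx.
Qed.

Lemma std_full_triples s :
  (std_triple s \in full_triples) = full_cycle s && full_cycle (rot_perm * s).
Proof. by rewrite inE /= full_cycle_rot full_cycleV mulgV eqxx andbT. Qed.

Lemma full_triplesJ t w : (conj_triple t w \in full_triples) = (t \in full_triples).
Proof.
rewrite !inE /conj_triple /= !full_cycleJ -!conjMg.
by rewrite -[X in _ == X](conj1g w) (inj_eq (conjg_inj w)).
Qed.

Lemma full_triples_std t :
  t \in full_triples -> exists s w, t = conj_triple (std_triple s) w.
Proof.
case: t => [[a b] c]; rewrite inE /sigma0 /sigma1 /sigmaoo /=.
case/and4P=> /full_cycle_conj[w def_a] _ _ /eqP abc1.
exists (b ^ w^-1), w; rewrite /conj_triple /sigma0 /sigma1 /sigmaoo /=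
  conjVg (conjMg rot_perm) conjgKV def_a.
by congr (_, _); apply/esym/eqP; rewrite eq_invg_mul abc1.
Qed.

(** The conjugating permutation fixes the rotation in the first entry, so it lies in its
    centraliser, which consists of the powers of the rotation. *)
Lemma std_triple_iso s s' : belyi_iso (std_triple s) (std_triple s') ->
  exists2 k, k < n.+1 & s ^ (rot_perm ^+ k) = s'.
Proof.
case/existsP=> w /eqP[rw <- _].
have [|k ltk ->] := @cent_rot_perm _ w; first by apply/commgP/conjg_fixP.
by exists k.
Qed.

Lemma std_triple_conj s k :
  conj_triple (std_triple s) (rot_perm ^+ k) = std_triple (s ^ (rot_perm ^+ k)).
Proof.
rewrite /conj_triple /std_triple /= conjVg conjMg.
suff -> : rot_perm ^ (rot_perm ^+ k) = rot_perm by [].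
by apply/conjg_fixP/commgP; apply: commuteX.
Qed.

(** Every full triple is conjugate to some [std_triple s], with [s] unique up to conjugation by
    powers of the rotation; so it suffices to list one [s] per orbit. *)
Lemma card_iso_classes (P : pred (perm_triple n.+1)) (r : seq {perm 'I_n.+1}) :
    conj_invariant P -> uniq r ->
    {in r, forall s, std_triple s \in full_triples /\ P (std_triple s)} ->
    (forall s, std_triple s \in full_triples -> P (std_triple s) ->
       exists k, s ^ (rot_perm ^+ k) \in r) ->
    {in r &, forall s s' k, k < n.+1 -> s ^ (rot_perm ^+ k) = s' -> s = s'} ->
  #|iso_classes [set t in full_triples | P t]| = size r.
Proof.
move=> invP r_uniq rP r_cover r_sep.
rewrite -(size_map std_triple); apply: card_partition_reps.
- exact: belyi_iso_equivalence.
- by rewrite map_inj_uniq // => s s' [].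
- by move=> _ /mapP[s /rP[Fs Ps] ->]; rewrite inE Fs.
- move=> t; rewrite inE => /andP[Ft Pt].
  have [s [w def_t]] := full_triples_std Ft.
  have [] := r_cover s; rewrite ?def_t ?full_triplesJ ?invP // in Ft Pt *.
  move=> k rs; apply/hasP; exists (std_triple (s ^ (rot_perm ^+ k))).
    exact: map_f.
  (* Conjugation by [w^-1] returns to the normal form; the power of the rotation then moves [s] into
     the list. *)
  apply/existsP; exists (w^-1 * rot_perm ^+ k); rewrite -std_triple_conj.
  by rewrite /conj_triple /= !conjgM !conjgK.
move=> _ _ /mapP[s rs ->] /mapP[s' rs' ->] /std_triple_iso[k ltk ss'].
by rewrite (r_sep s s' rs rs' k).
Qed.

(** One list of representatives of all classes serves every invariant property, by filtering. *)
Lemma count_iso_classes (P : pred (perm_triple n.+1)) (r : seq {perm 'I_n.+1}) :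
    conj_invariant P -> uniq r ->
    {in r, forall s, std_triple s \in full_triples} ->
    (forall s, std_triple s \in full_triples ->
       exists k, s ^ (rot_perm ^+ k) \in r) ->
    {in r &, forall s s' k, k < n.+1 -> s ^ (rot_perm ^+ k) = s' -> s = s'} ->
  #|iso_classes [set t in full_triples | P t]| = count (fun s => P (std_triple s)) r.
Proof.
move=> invP r_uniq rP r_cover r_sep; rewrite -size_filter.
apply: card_iso_classes => //.
- by rewrite filter_uniq.
- by move=> s; rewrite mem_filter => /andP[Ps /rP].
- move=> s /r_cover[k rs] Ps; exists k.
  by rewrite mem_filter rs -std_triple_conj invP Ps.
by move=> s s' /[!mem_filter] /andP[_ rs] /andP[_ rs']; apply: r_sep.
Qed.

Lemma passport_full t :
  (is_belyi t && (passport t == ([:: n.+1], [:: n.+1], [:: n.+1])))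
   = (t \in full_triples).
Proof.
have typeE s : (cycle_type s == [:: n.+1]) = full_cycle s.
  apply/eqP/idP => [/(congr1 size) | s0].
    by rewrite size_sort size_map -cardE => /= /full_cycleP.
  have : porbit s ord0 \in porbits s by apply: imset_f.
  have /full_cycleP/eqP/cards1P[O sO] := s0.
  rewrite /cycle_type sO enum_set1 inE /= => /eqP<-.
  by rewrite (eqP s0) cardsT card_ord.
apply/idP/idP => [/andP[/andP[_ t1]] | Ft].
  by rewrite !xpair_eqE !typeE inE t1 andbT andbA.
rewrite full_triples_belyi //; move: Ft; rewrite inE => /and4P[t0 t1 too _].
by rewrite !xpair_eqE !typeE t0 t1.
Qed.

End Triples.

(* For [d = 2 g + 1], the Riemann-Hurwitz relation forces equality in the three
   bounds [ramification s <= d - 1]. *)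
Lemma extremal_mapsE g : extremal_maps g = full_triples g.*2.
Proof.
apply/setP=> t; have ram s := @ramification_leq g.*2 s.
have sumE : g.*2 + (g.*2.+1).*2 = (2 + (g.*2 + g.*2 + g.*2))%N.
  by rewrite doubleS -(addnn g.*2) !addnS addnA.
rewrite inE; apply/andP/idP => [[/andP[_ t1]] | Ft].
  rewrite /has_genus sumE eqn_add2l inE t1 andbT eq_sym.
  by rewrite (leqif_add (leqif_add (ram _) (ram _)) (ram _)) andbA.
split; first exact: full_triples_belyi.
move: Ft; rewrite inE => /and4P[t0 t1 too _]; rewrite /has_genus sumE eqn_add2l eq_sym.
by rewrite (leqif_add (leqif_add (ram _) (ram _)) (ram _)) t0 t1.
Qed.

(** * Permutations as sequences *)

(** Composition in one-line notation, from left to right as for permutations: first [a], then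
    [b]. *)
Definition lmul (a b : seq nat) : seq nat := [seq nth 0 b x | x <- a].

Definition lcyclic (a : seq nat) : bool := uniq (traject (nth 0 a) 0 (size a)).

Definition lrot d k : seq nat := [seq (i + k) %% d | i <- iota 0 d].

Arguments lmul : simpl never.
Arguments lrot : simpl never.

(** Conjugacy by a power [r] of the rotation, in the form [a * r = r * b], which avoids inverses. *)
Definition lconj d (a b : seq nat) : bool :=
  has (fun k => lmul a (lrot d k) == lmul (lrot d k) b) (iota 0 d).

Definition lfull d (a : seq nat) : bool := lcyclic a && lcyclic (lmul (lrot d 1) a).

(** Decidable test that [r] contains exactly one second entry of a normal form per class; the last
    clause runs through all [d!] permutations. *)
Definition reps_ok d (r : seq (seq nat)) : bool :=
  [&& uniq r, all (fun a => perm_eq a (iota 0 d) && lfull d a) r,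
      all (fun a => all (fun b => (a == b) || ~~ lconj d a b) r) r
    & all (fun a => lfull d a ==> has (lconj d a) r) (permutations (iota 0 d))].

(* [word a b [:: e0; e1; e2; ...]] is the product [a ^ e0 * b ^ e1 * a ^ e2 ...]. *)
Fixpoint word (T : Type) (mul : T -> T -> T) (one a b : T) (w : seq nat) : T :=
  if w is e :: w' then iter e (mul a) (word mul one b a w') else one.

Definition ltperm d (x y : nat) : seq nat :=
  [seq if i == x then y else if i == y then x else i | i <- iota 0 d].

(** With [tau] the transposition, the final equation says that the word equals [c ^ tau], in the
    form [tau * word = c * tau], free of inverses. *)
Definition alt_cert d (cert : seq nat * seq nat * (nat * nat)) : bool :=
  let: (a, w, (x, y)) := cert in
  [&& perm_eq a (iota 0 d), lfull d a, x < d, y < d, x != y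
    & lmul (ltperm d x y) (word lmul (iota 0 d) (lrot d 1) a w)
      == lmul (lrot d 1) (ltperm d x y)].

Lemma word_in (gT : finGroupType) (G : {group gT}) (a b : gT) (w : seq nat) :
  a \in G -> b \in G -> word mulg 1 a b w \in G.
Proof.
elim: w a b => [|e w IHw] a b Ga Gb /=; first exact: group1.
by elim: e => [|e IHe] /=; rewrite ?groupM ?IHw.
Qed.

Lemma leq_mul_card (gT : finGroupType) (G H : {group gT}) : #|G * H| <= #|G| * #|H|.
Proof. by rewrite mul_cardG leq_pmulr ?cardG_gt0. Qed.

Section Code.
Variable n : nat.
Implicit Types s t : {perm 'I_n.+1}.
Local Notation rot_perm := (rot_perm n).

Definition code s : seq nat := [seq val (s i) | i <- enum 'I_n.+1].

(** Inverse of [code], obtained by choice; computations take place on sequences instead. The value 1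
    is a default for sequences that are not permutations. *)
Definition decode (a : seq nat) : {perm 'I_n.+1} := odflt 1 [pick s | code s == a].

Lemma size_code s : size (code s) = n.+1.
Proof. by rewrite size_map size_enum_ord. Qed.

Lemma nth_code s (i : 'I_n.+1) : nth 0 (code s) i = s i.
Proof. by rewrite (nth_map i) ?size_enum_ord // nth_ord_enum. Qed.

Lemma code_inj : injective code.
Proof. by move=> s t eq_st; apply/permP=> i; apply: val_inj; rewrite /= -!nth_code eq_st. Qed.

Lemma eq_code s (a : seq nat) :
  size a = n.+1 -> (forall i : 'I_n.+1, nth 0 a i = s i) -> code s = a.
Proof.
move=> sz_a a_s; apply: (@eq_from_nth _ 0); rewrite size_code // => i lti.
by rewrite (nth_code s (Ordinal lti)) -a_s.
Qed.

Lemma codeM s t : code (s * t) = lmul (code s) (code t).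
Proof.
apply: eq_code => [|i]; first by rewrite size_map size_code.
by rewrite (nth_map 0) ?size_code // nth_code nth_code permM.
Qed.

Lemma code1 : code 1 = iota 0 n.+1.
Proof. by apply: eq_code => [|i]; rewrite ?size_iota // nth_iota // perm1. Qed.

Lemma code_rotX k : code (rot_perm ^+ k) = lrot n.+1 k.
Proof.
by apply: eq_code => [|i]; rewrite /lrot ?size_map ?size_iota // (nth_map 0) ?size_iota //
  nth_iota // add0n rot_permX.
Qed.

Lemma perm_code s : perm_eq (code s) (iota 0 n.+1).
Proof.
rewrite -val_enum_ord /code map_comp; apply: perm_map; apply: uniq_perm.
- by rewrite map_inj_uniq ?enum_uniq //; apply: perm_inj.
- exact: enum_uniq.
by move=> i; rewrite mem_enum inE; apply/mapP; exists (s^-1 i); rewrite ?mem_enum ?permKV.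
Qed.

Lemma decodeK (a : seq nat) : perm_eq a (iota 0 n.+1) -> code (decode a) = a.
Proof.
move=> pa; rewrite /decode; case: pickP => [s /eqP // | /= no_s].
have sz_a : size a = n.+1 by rewrite (perm_size pa) size_iota.
have lt_a (i : 'I_n.+1) : nth 0 a i < n.+1.
  have : nth 0 a i \in iota 0 n.+1 by rewrite -(perm_mem pa) mem_nth ?sz_a.
  by rewrite mem_iota.
have s_inj : injective (fun i => Ordinal (lt_a i)).
  move=> i j /(congr1 val)/= /eqP.
  by rewrite nth_uniq ?sz_a // ?(perm_uniq pa) ?iota_uniq // => /eqP/val_inj.
have /eqP[] := no_s (perm s_inj); apply: eq_code => // i.
by rewrite permE.
Qed.

Lemma codeK : cancel code decode.
Proof. by move=> s; apply: code_inj; rewrite decodeK ?perm_code. Qed.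

Lemma full_cycle_code s : full_cycle s = lcyclic (code s).
Proof.
have trajE m x : [seq val i | i <- traject s x m] = traject (nth 0 (code s)) (val x) m.
  by elim: m x => //= m IHm x; rewrite IHm nth_code.
by rewrite full_cycle_uniq /lcyclic size_code -(map_inj_uniq val_inj) trajE.
Qed.

Lemma code_word s t w :
  code (word mulg 1 s t w) = word lmul (iota 0 n.+1) (code s) (code t) w.
Proof.
elim: w s t => [|e w IHw] s t /=; first exact: code1.
by rewrite -IHw; elim: e => //= e <-; rewrite codeM.
Qed.

Lemma code_rot : code rot_perm = lrot n.+1 1.
Proof. by rewrite -code_rotX expg1. Qed.

Lemma code_tperm (x y : 'I_n.+1) : code (tperm x y) = ltperm n.+1 x y.
Proof.
apply: eq_code => [|i]; first by rewrite size_map size_iota.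
by rewrite (nth_map 0) ?size_iota // nth_iota // permE /= !(fun_if val).
Qed.

Lemma lfull_code s : lfull n.+1 (code s) = (std_triple s \in full_triples n).
Proof. by rewrite std_full_triples !full_cycle_code codeM code_rot. Qed.

Lemma lconj_code s t :
  reflect (exists2 k, k < n.+1 & s ^ (rot_perm ^+ k) = t) (lconj n.+1 (code s) (code t)).
Proof.
apply: (iffP hasP) => -[k ltk eq_k]; exists k; last 1 first.
- by rewrite -!code_rotX -!codeM -eq_k conjgE !mulgA mulgV mul1g.
- by move: ltk; rewrite mem_iota.
- move: eq_k; rewrite -!code_rotX -!codeM => /eqP eq_k.
  by rewrite conjgE (code_inj eq_k) mulKg.
by rewrite mem_iota.
Qed.

(** Read through [code], the clauses of [reps_ok] become the hypotheses of [count_iso_classes]. *)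
Lemma count_iso_classes_code (r : seq (seq nat)) (P : pred (perm_triple n.+1)) :
    reps_ok n.+1 r -> conj_invariant P ->
  #|iso_classes [set t in full_triples n | P t]|
    = count (fun a => P (std_triple (decode a))) r.
Proof.
case/and4P=> r_uniq /allP r_ok /allP r_sep /allP r_cover invP.
have rK : {in r, cancel decode code}.
  by move=> a /r_ok/andP[pa _]; apply: decodeK.
rewrite -(count_map decode (fun s => P (std_triple s))).
apply: count_iso_classes => //.
- by rewrite map_inj_in_uniq //; apply: can_in_inj rK.
- by move=> _ /mapP[a ra ->]; rewrite -lfull_code rK //; have /andP[] := r_ok a ra.
- move=> s; rewrite -lfull_code => s_full.
  have := r_cover (code s); rewrite mem_permutations perm_code s_full => /(_ isT)/hasP[a ra].
  rewrite -(rK a ra) => /lconj_code[k _ def_a]; exists k.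
  by rewrite def_a map_f.
move=> _ _ /mapP[a ra ->] /mapP[b rb ->] k ltk eq_ab.
have /allP/(_ b rb)/predU1P[->//|/negP[]] := r_sep a ra.
by rewrite -(rK a ra) -(rK b rb); apply/lconj_code; exists k.
Qed.

(** A full cycle on an odd number [n + 1] of letters is an even permutation. *)
Lemma monodromy_std_Alt s :
  ~~ odd n -> full_cycle s -> monodromy (std_triple s) \subset 'Alt_('I_n.+1).
Proof.
move=> n_even s_full; rewrite gen_subG; apply/subsetP=> t.
by rewrite in_set2 Alt_even => /orP[] /eqP->; rewrite full_cycle_odd ?full_cycle_rot //= !negbK.
Qed.

(* With [H = <c, c ^ tau>], the transposition [tau] normalises [H] and
   [<H, tau>] contains [c] and [tau], hence is the whole symmetric group;
   so [H] has index at most 2. *)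
Lemma Alt_of_rot_tperm (G : {group {perm 'I_n.+1}}) (x y : 'I_n.+1) :
    prime n.+1 -> x != y -> rot_perm \in G -> rot_perm ^ tperm x y \in G ->
    G \subset 'Alt_('I_n.+1) ->
  G :=: 'Alt_('I_n.+1).
Proof.
move=> n_prime neq_xy Gc Gct sGA; set tau := tperm x y.
pose H := <<[set rot_perm; rot_perm ^ tau]>>%G.
have sHG : H \subset G by rewrite gen_subG subUset !sub1set Gc Gct.
have tau2 : tau ^+ 2 = 1 by rewrite expgS expg1 tperm2.
have nHtau : tau \in 'N(H).
  rewrite inE -genJ gen_subG conjUg !conjg_set1 -conjgM tperm2 conjg1.
  by rewrite subUset !sub1set !mem_gen // !inE eqxx ?orbT.
have HtauT : H * <[tau]> = [set: {perm 'I_n.+1}].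
  rewrite -norm_joinEr ?cycle_subG //; apply/eqP; rewrite eqEsubset subsetT /=.
  (* On a prime number of letters, a transposition and an element of that prime order generate the
     symmetric group. *)
  have := @gen_tperm_circular_shift 'I_n.+1 x y rot_perm.
  rewrite card_ord order_rot_perm => /(_ n_prime neq_xy erefl) genS.
  suff : <<[set tau; rot_perm]>> \subset H <*> <[tau]> by rewrite genS.
  rewrite gen_subG subUset !sub1set (subsetP (joing_subr _ _)) ?cycle_id //=.
  by rewrite (subsetP (joing_subl _ _)) // mem_gen // !inE eqxx.
have n1 : 1 < #|'I_n.+1| by rewrite card_ord prime_gt1.
apply/eqP; rewrite eqEcard sGA -(leq_pmul2l (isT : 0 < 2)) card_Alt // -card_Sym.
apply: (@leq_trans #|H * <[tau]>|); first by rewrite HtauT.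
rewrite (leq_trans (leq_mul_card H <[tau]>)) // mulnC leq_mul ?subset_leq_card //.
by rewrite dvdn_leq // order_dvdn tau2.
Qed.

End Code.

(* Each entry [(s, w, (x, y))] records a representative [s] together with a word
   [w] in [c] and [s] equal to [c ^ tperm x y], found by breadth-first search. *)
Definition alt_reps5 : seq (seq nat * seq nat * (nat * nat)) :=
  ([:: ([:: 1; 3; 0; 4; 2], [:: 0; 2], (1, 3))])%N.

Definition alt_reps7 : seq (seq nat * seq nat * (nat * nat)) :=
  ([:: ([:: 1; 2; 3; 5; 0; 6; 4], [:: 0; 5; 1; 1; 1], (0, 1));
    ([:: 1; 2; 3; 6; 5; 0; 4], [:: 1; 1; 1; 5], (2, 3));
    ([:: 1; 2; 4; 5; 6; 0; 3], [:: 2; 1; 3; 1], (3, 4));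
    ([:: 1; 2; 5; 4; 0; 6; 3], [:: 4; 2], (2, 3));
    ([:: 1; 2; 5; 6; 0; 3; 4], [:: 5; 1], (1, 3));
    ([:: 1; 3; 0; 5; 2; 6; 4], [:: 0; 3], (1, 5));
    ([:: 1; 3; 0; 6; 5; 2; 4], [:: 0; 2; 4; 1; 1], (0, 1));
    ([:: 1; 3; 4; 6; 5; 0; 2], [:: 2; 1; 2; 1], (1, 2));
    ([:: 1; 3; 5; 6; 2; 0; 4], [:: 2; 2; 3], (0, 2));
    ([:: 1; 4; 0; 5; 6; 2; 3], [:: 0; 1; 1; 4; 1; 1], (5, 6));
    ([:: 1; 4; 0; 6; 5; 3; 2], [:: 1; 1; 1; 1], (1, 3));
    ([:: 1; 4; 5; 0; 2; 6; 3], [:: 3; 4], (1, 2));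
    ([:: 1; 5; 0; 4; 2; 6; 3], [:: 3; 2], (0, 1));
    ([:: 1; 5; 0; 6; 2; 3; 4], [:: 0; 1; 3; 2; 1; 1], (0, 4));
    ([:: 1; 5; 4; 0; 6; 2; 3], [:: 0; 1; 1; 1; 1; 1; 1], (0, 2));
    ([:: 1; 6; 4; 0; 5; 3; 2], [:: 1; 1; 4; 2], (4, 5));
    ([:: 1; 6; 4; 5; 0; 2; 3], [:: 0; 1; 1; 4; 1; 1], (2, 3));
    ([:: 1; 6; 5; 0; 2; 3; 4], [:: 0; 1; 1; 2; 3; 1], (1, 4));
    ([:: 2; 3; 6; 5; 1; 0; 4], [:: 0; 4], (4, 6));
    ([:: 2; 4; 5; 0; 6; 1; 3], [:: 1; 1; 1; 1], (2, 3));
    ([:: 2; 5; 6; 0; 1; 3; 4], [:: 4; 1], (2, 3));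
    ([:: 2; 6; 5; 1; 0; 3; 4], [:: 0; 3], (0, 2));
    ([:: 3; 5; 0; 6; 1; 2; 4], [:: 0; 2], (0, 6))])%N.

(** The powers [c ^ a] with [1 <= a <= d - 2]; for [d] prime these are the exponents with [a] and
    [a + 1] both nonzero modulo [d]. *)
Definition cyclic_reps d : seq (seq nat) := [seq lrot d a | a <- iota 1 (d - 2)].

(** The permutation of the seven splittings of P^1(F_7) induced by the transvection [upp 3], as
    checked in [compat_upp]. *)
Definition psl_rep : seq nat := [:: 1; 4; 5; 0; 6; 3; 2]%N.
(* The inverse of the conjugate of [psl_rep] by [i -> - i]. *)
Definition psl_rep' : seq nat := [:: 4; 3; 5; 6; 2; 1; 0]%N.

Definition reps3 := cyclic_reps 3.
Definition reps5 := cyclic_reps 5 ++ [seq c.1.1 | c <- alt_reps5].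
Definition reps7 := cyclic_reps 7 ++ [:: psl_rep; psl_rep'] ++ [seq c.1.1 | c <- alt_reps7].

(* [lazy] short-circuits the Boolean connectives; [vm_compute] does not. *)
Lemma reps3_ok : reps_ok 3 reps3. Proof. by lazy. Qed.
Lemma reps5_ok : reps_ok 5 reps5. Proof. by lazy. Qed.
Lemma reps7_ok : reps_ok 7 reps7. Proof. by lazy. Qed.
Lemma alt_reps5_ok : all (alt_cert 5) alt_reps5. Proof. by lazy. Qed.
Lemma alt_reps7_ok : all (alt_cert 7) alt_reps7. Proof. by lazy. Qed.

(** * Alternating groups and the Fano plane *)

Lemma monodromy_std_cyclic n a :
  monodromy (std_triple (rot_perm n ^+ a)) :=: <[rot_perm n]>.
Proof.
apply/eqP; rewrite eqEsubset gen_subG cycle_subG mem_gen ?andbT; last first.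
  by rewrite !inE eqxx.
by apply/subsetP=> s; rewrite in_set2 => /orP[] /eqP->; rewrite ?mem_cycle ?cycle_id.
Qed.

Lemma cycle_rot_isog n : <[rot_perm n]> \isog Zp n.+1.
Proof. by have := Zp_isog (rot_perm n); rewrite order_rot_perm isog_sym. Qed.

Lemma monodromy_alt_cert n (cert : seq nat * seq nat * (nat * nat)) :
    prime n.+1 -> ~~ odd n -> alt_cert n.+1 cert ->
  monodromy (std_triple (decode n cert.1.1)) :=: 'Alt_('I_n.+1).
Proof.
case: cert => [[a w] [x y]] /= n_pr n_even.
case/and5P=> /decodeK aK a_full lt_x lt_y /andP[neq_xy /eqP cert].
have s_full : full_cycle (decode n a).
  by move: a_full; rewrite -{1}aK lfull_code std_full_triples => /andP[].
pose G := monodromy (std_triple (decode n a)).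
have Gc : rot_perm n \in G by rewrite mem_gen // !inE eqxx.
have Gs : decode n a \in G by rewrite mem_gen // !inE eqxx orbT.
apply: (@Alt_of_rot_tperm n G (Ordinal lt_x) (Ordinal lt_y)) => //; last first.
  exact: monodromy_std_Alt.
(* The certificate writes the conjugate of the rotation as a word in the two generators, which
   places it in [G]. *)
rewrite (_ : _ ^ _ = word mulg 1 (rot_perm n) (decode n a) w) ?word_in //.
apply: (mulgI (tperm (Ordinal lt_x) (Ordinal lt_y))).
rewrite conjgE tpermV tpermKg; apply: code_inj.
by rewrite !codeM code_word code_tperm code_rot aK cert.
Qed.

(** Breadth-first enumeration of the products of at most [m] factors [a] or [b]. *)
Definition ball d (a b : seq nat) m : seq (seq nat) :=
  iter m (fun X => undup (X ++ [seq lmul x g | x <- X, g <- [:: a; b]])) [:: iota 0 d].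

(** The enumerated sequences are distinct codes of elements of [G], so evaluation bounds the order
    from below. *)
Lemma ball_card n (s t : {perm 'I_n.+1}) (G : {group {perm 'I_n.+1}}) m :
  s \in G -> t \in G -> size (ball n.+1 (code s) (code t) m) <= #|G|.
Proof.
move=> Gs Gt; rewrite cardE -(size_map (@code n)).
have sub : {subset ball n.+1 (code s) (code t) m <= [seq code g | g <- enum G]}.
  elim: m => [a|m IHm a].
    by rewrite /ball /iter inE -code1 => /eqP->; rewrite map_f ?mem_enum.
  rewrite /ball iterS -/(ball _ _ _ m) mem_undup mem_cat => /orP[/IHm //|].
  case/allpairsP=> [[x y] /= [/IHm/mapP[g Gg ->] y_st ->]].
  rewrite mem_enum in Gg; move: y_st; rewrite !inE => /orP[] /eqP->;
  by rewrite -codeM map_f // mem_enum groupM.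
by apply: uniq_leq_size sub; case: m => [//|m]; apply: undup_uniq.
Qed.

(** * Linear permutations of the Fano plane *)

Section Fano.

Import GRing.Theory.
Local Open Scope ring_scope.

Lemma line_F2 n (u : 'rV['F_2]_n) : line u = [set 0; u].
Proof.
apply/setP=> v; rewrite !inE; apply/imsetP/orP => [[a _ ->]|].
  by case: a => [[|[|a]] lta] //; [left|right]; rewrite ?scale0r ?scale1r //;
    apply/eqP; [rewrite -[RHS](scale0r u) | rewrite -[RHS](scale1r u)]; congr (_ *: _);
    apply: val_inj.
by case=> /eqP->; [exists 0; rewrite ?scale0r | exists 1; rewrite ?scale1r].
Qed.

(** The only scalars are 0 and 1, so projective points over F_2 may be identified with nonzero
    vectors. *)
Lemma line_F2_inj n (u v : 'rV['F_2]_n) : u != 0 -> line u = line v -> u = v.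
Proof.
move=> u0 eq_uv; have: u \in line v by rewrite -eq_uv line_F2 !inE eqxx orbT.
by rewrite line_F2 !inE (negPf u0) => /eqP.
Qed.

Lemma line_mulmx (F : finFieldType) n (u : 'rV[F]_n) (g : 'M[F]_n) :
  [set v *m g | v in line u] = line (u *m g).
Proof. by rewrite /line -imset_comp; apply: eq_imset => a /=; rewrite scalemxAl. Qed.

(** The successive images of the first basis vector under [e1 -> e2], [e2 -> e3], [e3 -> e1 + e3], a
    matrix of order 7; thus the rotation of the letters is linear. *)
Definition fano_coord : seq (seq nat) :=
  [:: [:: 1; 0; 0]; [:: 0; 1; 0]; [:: 0; 0; 1]; [:: 1; 0; 1]; [:: 1; 1; 1];
      [:: 1; 1; 0]; [:: 0; 1; 1]]%N.

Definition fano_vec (i : 'I_7) : 'rV['F_2]_3 :=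
  \row_j (nth 0 (nth [::] fano_coord i) j)%N%:R.

Lemma ord_all n (P : nat -> bool) : all P (iota 0 n) -> forall i : 'I_n, P i.
Proof. by move=> /allP allP i; apply: allP; rewrite mem_iota /=. Qed.

Lemma fano_vec_inj : injective fano_vec.
Proof.
move=> i j /matrixP eq_ij; apply/val_inj/eqP.
have {eq_ij} eq_ij k : (k < 3)%N -> odd (nth 0 (nth [::] fano_coord i) k)
    = odd (nth 0 (nth [::] fano_coord j) k).
  move=> ltk; have := eq_ij ord0 (Ordinal ltk); rewrite !mxE /= => /(congr1 val).
  by rewrite /= !val_Fp_nat // !modn2 => /eqP; do 2!case: odd.
move: (eq_ij 0%N isT) (eq_ij 1%N isT) (eq_ij 2%N isT) => {eq_ij}; move: i j.
by do 2!case=> [[|[|[|[|[|[|[|//]]]]]]] ?].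
Qed.

Lemma fano_vec_neq0 i : fano_vec i != 0.
Proof.
apply/eqP=> /rowP v0.
have odd_v0 k : (k < 3)%N -> ~~ odd (nth 0 (nth [::] fano_coord i) k)%N.
  move=> ltk; have := v0 (Ordinal ltk); rewrite !mxE /= => /(congr1 val).
  by rewrite /= val_Fp_nat // modn2; case: odd.
move: (odd_v0 0%N isT) (odd_v0 1%N isT) (odd_v0 2%N isT) => {v0 odd_v0}.
by case: i => [[|[|[|[|[|[|[|//]]]]]]] ?].
Qed.

(** Injectivity suffices, as there are [2^3 - 1 = 7] nonzero vectors. *)
Lemma fano_vec_onto u : u != 0 -> exists i, u = fano_vec i.
Proof.
move=> u0; suff /imsetP[i _ ->] : u \in fano_vec @: [set: 'I_7] by exists i.
suff -> : fano_vec @: [set: 'I_7] = [set~ 0] by rewrite !inE.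
apply/eqP; rewrite eqEcard (card_imset _ fano_vec_inj) cardsT card_ord cardsC1.
rewrite card_mx card_Fp // andbT; apply/subsetP=> _ /imsetP[i _ ->].
by rewrite !inE fano_vec_neq0.
Qed.

Definition fano_linear (a : seq nat) : bool :=
  let v i j := nth 0%N (nth [::] fano_coord i) j in
  all (fun i => all (fun j => v (nth 0%N a i) j ==
    sumn [seq v i k * v (nth 0 a k) j | k <- iota 0 3] %[mod 2])%N (iota 0 3)) (iota 0 7).

(* The first three vectors of [fano_coord] form the canonical basis, so the
   images of the first three letters are the rows of the matrix. *)
Lemma fano_linearP (s : {perm 'I_7}) : fano_linear (code s) ->
  exists g : {'GL_3['F_2]}, forall i, fano_vec (s i) = fano_vec i *m GLval g.
Proof.
move=> lin_s; pose A : 'M['F_2]_3 := \matrix_(k < 3) fano_vec (s (inord k)).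
have As i : fano_vec (s i) = fano_vec i *m A.
  apply/rowP=> j; rewrite [RHS]mxE; have /ord_all/(_ j)/eqP := ord_all lin_s i.
  rewrite nth_code => eq_ij.
  transitivity (\sum_(k < 3) (nth 0 (nth [::] fano_coord i) k
      * nth 0 (nth [::] fano_coord (nth 0 (code s) k)) j)%N%:R : 'F_2); last first.
    apply: eq_bigr => k _; rewrite !mxE natrM; congr (_ * (nth 0 (nth _ _ _) _)%N%:R).
    by rewrite -nth_code inordK // (leq_trans (ltn_ord k)).
  rewrite -natr_sum mxE -Fp_nat_mod // eq_ij Fp_nat_mod //; congr _%:R.
  by rewrite !big_ord_recl big_ord0 /= !addnA.
(* A nonzero row vector is some [fano_vec i], and its image [fano_vec (s i)] is nonzero; so [A] has
   trivial kernel. *)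
have uA : A \is a GRing.unit.
  rewrite -/(A \in unitmx) -row_free_unit; apply: inj_row_free => u; apply: contra_eq.
  by case/fano_vec_onto=> i ->; rewrite -As fano_vec_neq0.
by exists (FinRing.unit _ uA) => i; rewrite As.
Qed.

Definition fano_group : {set {perm 'I_7}} :=
  [set s : {perm 'I_7} | [exists g : {'GL_3['F_2]},
     [forall i, fano_vec (s i) == fano_vec i *m GLval g]]].

Lemma fano_groupP (s : {perm 'I_7}) :
  reflect (exists g : {'GL_3['F_2]}, forall i, fano_vec (s i) = fano_vec i *m GLval g)
          (s \in fano_group).
Proof.
rewrite inE; apply: (iffP existsP) => -[g s_g]; exists g.
  by move=> i; apply/eqP/(forallP s_g).
by apply/forallP=> i; apply/eqP.
Qed.

Lemma fano_group_set : group_set fano_group.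
Proof.
apply/group_setP; split=> [|s t].
  by apply/fano_groupP; exists 1%g => i; rewrite perm1 GL_1E mulmx1.
move=> /fano_groupP[g s_g] /fano_groupP[h t_h]; apply/fano_groupP; exists (g * h)%g => i.
by rewrite permM t_h s_g GL_MxE mulmxA.
Qed.

(** A permutation is determined by any matrix inducing it, so the group injects into GL_3(F_2), of
    order [8 * 1 * 3 * 7 = 168]. *)
Lemma fano_group_card : (#|fano_group| <= 168)%N.
Proof.
pose lin (s : {perm 'I_7}) := odflt 1%g
  [pick g : {'GL_3['F_2]} | [forall i, fano_vec (s i) == fano_vec i *m GLval g]].
have linP (s : {perm 'I_7}) :
  s \in fano_group -> forall i, fano_vec (s i) = fano_vec i *m GLval (lin s).
  rewrite inE /lin => /existsP[g s_g]; case: pickP => [h /= /forallP s_h | /(_ g)].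
    by move=> i; apply/eqP.
  by rewrite s_g.
have lin_inj : {in fano_group &, injective lin}.
  move=> s t Fs Ft eq_lin; apply/permP=> i; apply: fano_vec_inj.
  by rewrite linP // eq_lin -linP.
rewrite -(card_in_imset lin_inj); apply: leq_trans (max_card _) _.
by rewrite -cardsT card_GL ?card_Fp // unlock.
Qed.

(** The upper bound on [fano_group] forces equality; letter [i] is then labelled by the line through
    [fano_vec i]. *)
Lemma acts_as_on_Fano_plane_fano_group (G : {group {perm 'I_7}}) :
  G \subset fano_group -> (168 <= #|G|)%N -> acts_as_on_Fano_plane G.
Proof.
move=> sGF G168; have <- : fano_group = G.
  by apply/esym/eqP; rewrite eqEcard sGF (leq_trans fano_group_card).
exists (fun i => line (fano_vec i)); first split.
- by move=> i j /(line_F2_inj (fano_vec_neq0 i))/fano_vec_inj.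
- apply/setP=> L; apply/imsetP/imsetP=> -[u].
    by move=> _ ->; exists (fano_vec u); rewrite ?inE ?fano_vec_neq0.
  by rewrite inE => /fano_vec_onto[i ->] ->; exists i.
move=> s; split=> [/fano_groupP[g s_g]|[g s_g]]; [exists g | apply/fano_groupP; exists g] => i.
  by rewrite line_mulmx s_g.
by apply: line_F2_inj (fano_vec_neq0 _) _; rewrite -line_mulmx.
Qed.

End Fano.

Lemma acts_as_on_Fano_planeJ (G : {set {perm 'I_7}}) (w : {perm 'I_7}) :
  acts_as_on_Fano_plane G -> acts_as_on_Fano_plane (G :^ w).
Proof.
case=> f [f_inj f_onto] G_f; exists (f \o w^-1); first split.
- by apply: inj_comp f_inj perm_inj.
- rewrite -f_onto; apply/setP=> L; apply/imsetP/imsetP=> -[i _ ->] /=.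
    by exists (w^-1 i); rewrite ?inE.
  by exists (w i); rewrite ?inE //= permK.
move=> s; rewrite mem_conjg; split=> [/G_f[g s_g]|[g s_g]]; last apply/G_f; exists g => i /=.
  by rewrite -s_g permJ.
have := s_g (w i); rewrite /= permK => <-; congr f.
by rewrite -{1}[i](permK w) permJ.
Qed.

Lemma fano_linear_rot : fano_linear (lrot 7 1). Proof. by lazy. Qed.
Lemma fano_linear_psl : fano_linear psl_rep. Proof. by lazy. Qed.
(* 8 is the diameter of the Cayley graph. *)
Lemma psl_ball : size (ball 7 (lrot 7 1) psl_rep 8) = 168. Proof. by lazy. Qed.

(** * SL_2 over a finite field *)

Section SL2.

Import GRing.Theory.
Local Open Scope ring_scope.

Definition mx2 (R : Type) (a b c d : R) : 'M[R]_2 :=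
  \matrix_(i, j) if i == 0 then if j == 0 then a else b else if j == 0 then c else d.

Lemma mx2E (R : Type) (A : 'M[R]_2) : A = mx2 (A 0 0) (A 0 1) (A 1 0) (A 1 1).
Proof.
by apply/matrixP=> -[[|[|//]] i] [[|[|//]] j]; rewrite mxE; congr (A _ _); apply: val_inj.
Qed.

Lemma mulmx2 (R : comNzRingType) (a b c d a' b' c' d' : R) :
  mx2 a b c d *m mx2 a' b' c' d' =
  mx2 (a * a' + b * c') (a * b' + b * d') (c * a' + d * c') (c * b' + d * d').
Proof.
apply/matrixP=> -[[|[|//]] i] [[|[|//]] j];
by rewrite !mxE !big_ord_recl big_ord0 !mxE /= addr0.
Qed.

Lemma mul_row_mx2 (R : comNzRingType) (v : 'rV[R]_2) (a b c d : R) :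
  ((v *m mx2 a b c d) 0 0 = v 0 0 * a + v 0 1 * c) *
  ((v *m mx2 a b c d) 0 1 = v 0 0 * b + v 0 1 * d).
Proof.
have ord1E : lift ord0 ord0 = 1 :> 'I_2 by apply: val_inj.
by split; rewrite !mxE !big_ord_recl big_ord0 addr0 ord1E !mxE.
Qed.

Lemma det_mx2 (R : comNzRingType) (a b c d : R) : \det (mx2 a b c d) = a * d - b * c.
Proof.
rewrite (expand_det_row _ 0) !big_ord_recl big_ord0 /cofactor !det_mx11 !mxE /=.
by rewrite addr0 expr0 expr1 mul1r mulN1r mulrN.
Qed.

Lemma mx2_inj (R : Type) (a b c d a' b' c' d' : R) :
  mx2 a b c d = mx2 a' b' c' d' -> [/\ a = a', b = b', c = c' & d = d'].
Proof.
by move=> /matrixP E; have := (E 0 0, E 0 1, E 1 0, E 1 1); rewrite !mxE /= => -[[[]]].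
Qed.

Variable F : finFieldType.
Implicit Types (g h : {'GL_2[F]}) (x y : F).

Lemma mx2_low_unit x : mx2 1 0 x 1 \is a GRing.unit.
Proof. by rewrite -[_ \is a _]/(_ \in unitmx) unitmxE det_mx2 mulr1 mul0r subr0 unitr1. Qed.

Lemma mx2_upp_unit x : mx2 1 x 0 1 \is a GRing.unit.
Proof. by rewrite -[_ \is a _]/(_ \in unitmx) unitmxE det_mx2 mulr1 mulr0 subr0 unitr1. Qed.

(** Transvections acting on row vectors: [low x] sends [(u, v)] to [(u + x v, v)], which translates
    the ratio [u / v] by [x]. *)
Definition low x : {'GL_2[F]} := FinRing.unit _ (mx2_low_unit x).
Definition upp x : {'GL_2[F]} := FinRing.unit _ (mx2_upp_unit x).

Lemma lowD x y : low (x + y) = (low x * low y)%g.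
Proof.
by apply: val_inj; rewrite /= -[RHS]/(_ *m _) mulmx2; congr mx2; ring.
Qed.

Lemma uppD x y : upp (x + y) = (upp x * upp y)%g.
Proof.
by apply: val_inj; rewrite /= -[RHS]/(_ *m _) mulmx2; congr mx2; ring.
Qed.

Lemma low0 : low 0 = 1%g.
Proof. by apply: (mulgI (low 0)); rewrite -lowD addr0 mulg1. Qed.

Lemma upp0 : upp 0 = 1%g.
Proof. by apply: (mulgI (upp 0)); rewrite -uppD addr0 mulg1. Qed.

Lemma lowX x k : low (x *+ k) = (low x ^+ k)%g.
Proof. by elim: k => [|k IHk]; rewrite ?low0 // mulrS lowD IHk expgS. Qed.

Lemma uppX x k : upp (x *+ k) = (upp x ^+ k)%g.
Proof. by elim: k => [|k IHk]; rewrite ?upp0 // mulrS uppD IHk expgS. Qed.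

Lemma low_natr_in (G : {group {'GL_2[F]}}) k : low 1 \in G -> low k%:R \in G.
Proof. by rewrite lowX; apply: groupX. Qed.

Lemma upp_mulrn_in (G : {group {'GL_2[F]}}) x k : upp x \in G -> upp (x *+ k) \in G.
Proof. by rewrite uppX; apply: groupX. Qed.

Lemma mulmx_GLKV g (v : 'rV[F]_2) : v *m GLval g^-1 *m GLval g = v.
Proof. exact: mulmxKV (GL_unitmx g) _. Qed.

(** If the lower left entry [c] is nonzero, the matrix is an explicit product upper, lower, upper.
    If [c = 0], multiplication by [low 1] turns this entry into [d], which is nonzero since the
    determinant is 1. *)
Lemma SL2_transvections (G : {group {'GL_2[F]}}) :
  (forall x, low x \in G) -> (forall x, upp x \in G) -> SL 2 F \subset G.
Proof.
move=> Glow Gupp.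
have SLc g : \det (GLval g) = 1 -> GLval g 1 0 != 0 -> g \in G.
  move=> det1 c0; have def_g := mx2E (GLval g); move: det1 c0; rewrite {1}def_g det_mx2.
  move: def_g; set a := GLval g 0 0; set b := GLval g 0 1; set c := GLval g 1 0.
  set d := GLval g 1 1 => def_g det1 c0.
  suff -> : g = (upp ((a - 1) / c)%R * low c * upp ((d - 1) / c)%R)%g by rewrite !groupM.
  apply: val_inj; rewrite /= -[RHS]/(_ *m _ *m _) def_g !mulmx2.
  have -> : b = (a * d - 1) / c by rewrite -det1; field.
  by congr mx2; field.
apply/subsetP=> g; rewrite inE => /eqP det1.
have [c0|] := eqVneq (GLval g 1 0) 0; last exact: SLc.
rewrite -(groupMr _ (Glow 1)); apply: SLc; rewrite GL_MxE ?det_mulmx ?det1 ?det_mx2.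
  by rewrite !(mulr1, mul0r, subr0).
rewrite {1}[GLval g]mx2E mulmx2 mxE /= c0 mul0r add0r mulr1.
apply: contra_eq_neq det1 => d0.
by rewrite [GLval g]mx2E det_mx2 c0 d0 !mulr0 subr0 eq_sym oner_neq0.
Qed.

(** SL_2 is the kernel of the determinant, which maps GL_2 onto the [q - 1] units (take diagonal
    matrices [u, 1]), where [q] is the order of [F]. *)
Lemma card_SL2 : #|SL 2 F| = (#|F| * (#|F| ^ 2 - 1))%N.
Proof.
have det_unit g : \det (GLval g) \is a GRing.unit by rewrite unitfE GL_det.
pose f g : {unit F} := FinRing.unit _ (det_unit g).
have fM : {in [set: {'GL_2[F]}] &, {morph f : g h / (g * h)%g}}.
  by move=> g h _ _; apply: val_inj; rewrite /= -[LHS]/(\det (_ *m _)) det_mulmx.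
pose phi := Morphism fM.
have ker_phi : 'ker phi = SL 2 F.
  apply/setP=> g; rewrite !inE /=; apply/eqP/eqP => [/(congr1 val)//|det1].
  exact: val_inj.
have im_phi : phi @* [set: {'GL_2[F]}] = [set: {unit F}].
  apply/setP=> u; rewrite inE; apply/morphimP.
  have du : mx2 (val u) 0 0 1 \is a GRing.unit.
    by rewrite -[_ \is a _]/(_ \in unitmx) unitmxE det_mx2 mulr1 mulr0 subr0 (valP u).
  exists (FinRing.unit _ du); rewrite ?inE //; apply: val_inj.
  by rewrite /= det_mx2 mulr1 mulr0 subr0.
have index_ker : #|[set: {'GL_2[F]}] : 'ker phi| = #|F|.-1.
  rewrite -card_quotient ?ker_norm // (card_isog (first_isog phi)).
  by rewrite -card_finField_unit -im_phi.
have eqc := Lagrange (subsetT ('ker phi)).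
have {}eqc : (#|SL 2 F| * #|F|.-1 = #|F| * #|F|.-1 ^ 2 * #|F|.+1)%N.
  by rewrite -(card_GL_2 F) -eqc index_ker -ker_phi.
move: eqc.
have [m ->] : exists m, #|F| = m.+2.
  by exists #|F|.-2; have := finRing_gt1 F; case: #|F| => [|[]].
have -> : (m.+2 ^ 2 - 1 = m.+1 * m.+3)%N by rewrite (subn_sqr m.+2 1) subn1 addn1.
move=> eqc; apply/eqP; rewrite -(eqn_pmul2r (ltn0Sn m)) eqc -!mulnA mulnCA.
by rewrite [X in _ == X]mulnCA /= (mulnC m.+3).
Qed.

(** Commuting with [low 1] and [upp 1] already forces a scalar matrix, and the determinant gives
    [a ^+ 2 = 1]. *)
Lemma SL2_center (g : {'GL_2[F]}) : g \in 'Z(SL 2 F) ->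
  exists2 a : F, a ^+ 2 = 1 & GLval g = mx2 a 0 0 a.
Proof.
have SLlow : low 1 \in SL 2 F by rewrite inE det_mx2 mulr1 mul0r subr0.
have SLupp : upp 1 \in SL 2 F by rewrite inE det_mx2 mulr1 mulr0 subr0.
case/centerP; rewrite inE => /eqP det1 cent_g; have def_g := mx2E (GLval g).
have comm_g (h : {'GL_2[F]}) : h \in SL 2 F -> GLval g *m GLval h = GLval h *m GLval g.
  by move=> /cent_g /(congr1 val).
have := comm_g _ SLupp; have := comm_g _ SLlow.
rewrite /= def_g !mulmx2 !(mulr1, mul1r, mulr0, mul0r, addr0, add0r).
move=> eqL eqU; have [b0 _ _ _] := mx2_inj eqL; have [c0 ad _ _] := mx2_inj eqU.
have {}b0 : GLval g 0 1 = 0 by apply: (addrI (GLval g 0 0)); rewrite b0 addr0.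
have {}c0 : GLval g 1 0 = 0 by apply: (addrI (GLval g 0 0)); rewrite -c0 addr0.
move: ad; rewrite b0 addr0 add0r => ad; exists (GLval g 0 0); last by rewrite -ad c0.
by move: det1; rewrite {1}def_g det_mx2 b0 mul0r subr0 -ad expr2.
Qed.

Lemma mx2_opp1_unit : mx2 (-1) 0 0 (-1) \is a @GRing.unit 'M[F]_2.
Proof.
by rewrite -[_ \is a _]/(_ \in unitmx) unitmxE det_mx2 mulrNN mulr1 mul0r subr0 unitr1.
Qed.

Definition opp1 : {'GL_2[F]} := FinRing.unit _ mx2_opp1_unit.

Lemma center_SL2 : 'Z(SL 2 F) = [set 1%g; opp1].
Proof.
apply/setP=> g; rewrite in_set2; apply/idP/orP => [/SL2_center[a]|].
  move/eqP; rewrite sqrf_eq1 => /orP[] /eqP -> def_g; [left | right]; apply/eqP/val_inj.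
    by rewrite /= def_g [RHS]mx2E !mxE.
  by rewrite /= def_g.
case=> /eqP->; first exact: group1.
apply/centerP; split=> [|h _].
  by rewrite inE det_mx2 mulrNN mulr1 mul0r subr0.
apply: val_inj; rewrite -[LHS]/(mx2 (-1) 0 0 (-1) *m GLval h) [GLval h]mx2E.
by rewrite -[RHS]/(GLval h *m mx2 (-1) 0 0 (-1)) [GLval h in RHS]mx2E !mulmx2; congr mx2; ring.
Qed.

Lemma card_center_SL2 : (2%:R : F) != 0 -> #|'Z(SL 2 F)| = 2%N.
Proof.
move=> F2; rewrite center_SL2 cards2; suff -> : 1%g != opp1 by [].
apply: contraNneq F2 => /(congr1 val) eq1.
have [+ _ _ _] := mx2_inj (etrans (esym (mx2E _)) eq1).
by rewrite mxE /= => /eqP; rewrite -subr_eq0 opprK.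
Qed.

Lemma card_PSL2 : (2%:R : F) != 0 -> (#|PSL 2 F| * 2 = #|F| * (#|F| ^ 2 - 1))%N.
Proof.
move=> F2; rewrite -card_SL2 /PSL card_quotient ?normal_norm ?center_normal // mulnC.
rewrite -[X in (X * _)%N](card_center_SL2 F2).
exact: Lagrange (center_sub (SL_group 2 F)).
Qed.

End SL2.

(** * The action of SL_2(F_7) on seven letters *)

Section PSLaction.

Import GRing.Theory.
Local Open Scope ring_scope.

Local Notation F := 'F_7.
Implicit Types (g h : {'GL_2[F]}) (s t : {perm 'I_7}).

(* [(x : y)] lies in the block { oo, i + squares } of P^1(F_7): the expression
   [x y - i y^2 = y^2 (x / y - i)] is cubed to give its Legendre symbol. *)
Definition block (i x y : F) : bool := (y == 0) || ((x * y - i * y ^+ 2) ^+ 3 == 1).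

Definition vblock (i : 'I_7) (v : 'rV[F]_2) : bool := block i%:R (v 0 0) (v 0 1).

(* [g] maps the splitting [i] to the splitting [s i]; the Boolean [e] tells
   whether it exchanges the two blocks. *)
Definition compat (g : {'GL_2[F]}) (s : {perm 'I_7}) : bool :=
  [forall i : 'I_7, [exists e : bool, [forall v : 'rV[F]_2,
    (v != 0) ==> (vblock i v == e (+) vblock (s i) (v *m GLval g))]]].

Lemma compatP g s :
  reflect (forall i, exists e, forall v, v != 0 -> vblock i v = e (+) vblock (s i) (v *m GLval g))
          (compat g s).
Proof.
apply: (iffP forallP) => gs i.
  by have /existsP[e /forallP e_gs] := gs i; exists e => v v0; apply/eqP/(implyP (e_gs v)).
have [e e_gs] := gs i; apply/existsP; exists e; apply/forallP=> v; apply/implyP=> v0.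
by rewrite e_gs.
Qed.

Lemma compat1 : compat 1 1.
Proof. by apply/compatP=> i; exists false => v _; rewrite perm1 GL_1E mulmx1. Qed.

Lemma mulmx_GL_neq0 (g : {'GL_2[F]}) (v : 'rV[F]_2) : v != 0 -> v *m GLval g != 0.
Proof.
apply: contraNneq => vg0; apply/eqP; apply: (can_inj (mulmxK (GL_unitmx g))).
by rewrite vg0 mul0mx.
Qed.

Lemma compatM g h s t : compat g s -> compat h t -> compat (g * h)%g (s * t)%g.
Proof.
move=> /compatP gs /compatP ht; apply/compatP=> i.
have [e e_gs] := gs i; have [e' e_ht] := ht (s i); exists (e (+) e') => v v0.
by rewrite e_gs // e_ht ?mulmx_GL_neq0 // permM GL_MxE mulmxA addbA.
Qed.

(** An explicit list, so that statements about all of F_7 are decided by evaluation. *)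
Definition elems : seq F := [seq inZp k | k <- iota 0 7].

Lemma elems_all (P : F -> bool) : all P elems -> forall x, P x.
Proof.
move=> /allP allP x; rewrite -(valZpK x); apply/allP/map_f; rewrite mem_iota /=.
exact: (ltn_ord x).
Qed.

(** The point at infinity lies in every block, which forces [e = false]; that distinct translates of
    the set of squares differ is checked over F_7. *)
Lemma block_sep (j k : F) (e : bool) :
  (forall x y, (x != 0) || (y != 0) -> block j x y = e (+) block k x y) -> j = k.
Proof.
move=> eq_jk; have e0 : e = false by have := eq_jk 1 0 isT; rewrite /block eqxx; case: e {eq_jk}.
have {}eq_jk x : block j x 1 = block k x 1 by rewrite eq_jk ?orbT // e0.
suff : all (fun j => all (fun k =>
    all (fun x => block j x 1 == block k x 1) elems ==> (j == k)) elems) elems.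
  move=> /elems_all/(_ j)/elems_all/(_ k)/implyP jk; apply/eqP/jk.
  by apply/allP=> x _; apply/eqP.
by lazy.
Qed.

Lemma row2_neq0 (x y : F) :
  (x != 0) || (y != 0) -> \row_j (if j == 0 then x else y) != 0 :> 'rV[F]_2.
Proof.
apply: contraTneq => /rowP v0; have := v0 0; have := v0 1; rewrite !mxE /= => -> ->.
by rewrite eqxx.
Qed.

(** Pulling vectors back by [g^-1] shows that the splittings [s i] and [t i] have the same blocks up
    to exchange; [block_sep] then identifies the letters. *)
Lemma compat_uniq g s t : compat g s -> compat g t -> s = t.
Proof.
move=> /compatP gs /compatP gt; apply/permP=> i; apply/val_inj.
have [e e_gs] := gs i; have [e' e_gt] := gt i.
suff /(congr1 val) : (s i)%:R = (t i)%:R :> F.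
  by rewrite /= !val_Fp_nat // !modn_small.
apply: (@block_sep _ _ (e (+) e')) => x y xy.
pose v := \row_j (if j == 0 then x else y) : 'rV[F]_2.
have v0 : v != 0 by apply: row2_neq0.
have := e_gs _ (mulmx_GL_neq0 g^-1 v0); rewrite e_gt ?mulmx_GL_neq0 //.
rewrite mulmx_GLKV /vblock !mxE /=.
by move/(congr1 (addb e)); rewrite addbA addKb => <-; rewrite -addbA.
Qed.

Definition psl_gen : {perm 'I_7} := decode 6 psl_rep.

Lemma vblock_mul (i : 'I_7) (v : 'rV[F]_2) (a b c d : F) :
  vblock i (v *m mx2 a b c d) = block i%:R (v 0 0 * a + v 0 1 * c) (v 0 0 * b + v 0 1 * d).
Proof. by rewrite /vblock !mul_row_mx2. Qed.

Lemma row2_eq0 (v : 'rV[F]_2) : v 0 0 = 0 -> v 0 1 = 0 -> v = 0.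
Proof.
move=> v0 v1; apply/rowP=> -[[|[|//]] ltj]; rewrite mxE; [rewrite -v0 | rewrite -v1];
by congr (v _ _); apply: val_inj.
Qed.

(** The form [x y - i y^2] is unchanged when [x] becomes [x + y] and [i] becomes [i + 1]. *)
Lemma compat_low : compat (low (1 : F)) (rot_perm 6).
Proof.
apply/compatP=> i; exists false => v _; rewrite vblock_mul /vblock.
have -> : (rot_perm 6 i)%:R = i%:R + 1 :> F.
  by rewrite -[rot_perm 6]expg1 rot_permX Fp_nat_mod // natrD.
by rewrite addFb mulr0 add0r !mulr1 /block; congr (_ || (_ ^+ 3 == 1)); ring.
Qed.

Lemma compat_upp : compat (upp (3 : F)) psl_gen.
Proof.
apply/compatP=> i.
(* A finite check over the seven letters and the pairs of elements of F_7, with the exchange of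
   blocks depending on the letter. *)
suff : all (fun i => has (fun e => all (fun x => all (fun y => ((x != 0) || (y != 0)) ==>
   (block i%:R x y == e (+) block (nth 0%N psl_rep i)%:R x (x * 3 + y))) elems) elems)
   [:: true; false]) (iota 0 7).
  move=> /ord_all/(_ i)/hasP[e _ /elems_all e_i]; exists e => v v0; rewrite vblock_mul.
  have /elems_all/(_ (v 0 1))/implyP e_xy := e_i (v 0 0).
  rewrite mulr1 mulr0 addr0 mulr1 /vblock (eqP (e_xy _)).
    by rewrite -(@decodeK 6 psl_rep) ?nth_code.
  by apply: contraR v0; rewrite negb_or !negbK => /andP[/eqP v0 /eqP v1]; apply/eqP/row2_eq0.
by lazy.
Qed.

End PSLaction.

(** * PSL_2(F_7) as a monodromy group *)

Section PSLiso.

Import GRing.Theory.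
Local Open Scope ring_scope.
Local Notation F := 'F_7.

(** The matrices admitting a compatible permutation form a group containing [low 1] and [upp 3],
    whose powers are all the transvections. *)
Lemma SL_compat g : g \in SL 2 F -> exists s, compat g s.
Proof.
pose D := [set g : {'GL_2[F]} | [exists s, compat g s]].
have D_group : group_set D.
  apply/group_setP; split=> [|g1 g2].
    by rewrite inE; apply/existsP; exists 1%g; apply: compat1.
  rewrite !inE => /existsP[s1 gs1] /existsP[s2 gs2]; apply/existsP; exists (s1 * s2)%g.
  exact: compatM.
have Dlow x : low x \in Group D_group.
  have := @low_natr_in _ (Group D_group) x; rewrite natr_Zp; apply.
  by rewrite inE; apply/existsP; exists (rot_perm 6); apply: compat_low.
have Dupp x : upp x \in Group D_group.
  (* 5 is the inverse of 3 modulo 7. *)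
  have -> : x = 3 *+ nat_of_ord (x * 5 : F).
    by rewrite -[RHS]mulr_natr natr_Zp; apply/eqP; move: x; apply: elems_all; lazy.
  apply: upp_mulrn_in.
  by rewrite inE; apply/existsP; exists psl_gen; apply: compat_upp.
by move=> /(subsetP (SL2_transvections Dlow Dupp)); rewrite inE => /existsP.
Qed.

(** Uniqueness of the compatible permutation makes the chosen one multiplicative. *)
Lemma SL_action : exists f : {morphism SL 2 F >-> {perm 'I_7}},
  {in SL 2 F, forall g, compat g (f g)}.
Proof.
pose f (g : {'GL_2[F]}) : {perm 'I_7} := odflt 1%g [pick s | compat g s].
have fP : {in SL 2 F, forall g, compat g (f g)}.
  move=> g /SL_compat[s gs]; rewrite /f; case: pickP => [//|/(_ s)].
  by rewrite gs.
have fM : {in SL 2 F &, {morph f : g h / (g * h)%g}}.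
  move=> g h SLg SLh; apply: (@compat_uniq (g * h)%g); last exact: compatM (fP g SLg) (fP h SLh).
  exact: fP (@groupM _ (SL_group 2 F) g h SLg SLh).
by exists (Morphism fM).
Qed.

(** The form [x y - i y^2] has even degree, so a change of sign of both coordinates preserves every
    block. *)
Lemma compat_opp1 : compat (opp1 F) 1.
Proof.
apply/compatP=> i; exists false => v _; rewrite perm1 vblock_mul addFb /vblock /block.
rewrite !mulr0 add0r addr0 !mulrN1 oppr_eq0; congr (_ || (_ ^+ 3 == 1)); ring.
Qed.

(** Enumeration and the Fano plane squeeze the order to 168. The image of SL_2(F_7) contains this
    group and the kernel contains the centre, of order 2; since [2 * 168 = 336] is the order of
    SL_2(F_7), both inclusions are equalities. *)
Lemma psl_monodromy :
  [/\ monodromy (std_triple psl_gen) \isog PSL 2 F,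
      #|monodromy (std_triple psl_gen)| = 168%N,
      #|PSL 2 F| = 168%N
    & monodromy (std_triple psl_gen) \subset fano_group].
Proof.
have code_gen : code psl_gen = psl_rep by apply: decodeK.
pose G := monodromy (std_triple psl_gen).
have Gc : rot_perm 6 \in G by rewrite mem_gen // !inE eqxx.
have Gs : psl_gen \in G by rewrite mem_gen // !inE eqxx orbT.
have G168 : (168 <= #|G|)%N.
  by rewrite -psl_ball -code_gen -code_rot; apply: ball_card.
have sGfano : G \subset fano_group.
  rewrite (gen_subG _ (Group fano_group_set)); apply/subsetP=> s.
  rewrite in_set2 => /orP[] /eqP->; apply/fano_groupP/fano_linearP.
    by rewrite code_rot fano_linear_rot.
  by rewrite code_gen fano_linear_psl.
have cardG : #|G| = 168%N.
  by apply/eqP; rewrite eqn_leq G168 (leq_trans (subset_leq_card sGfano)) ?fano_group_card.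
have card_SL : #|SL 2 F| = 336%N by rewrite card_SL2 card_Fp.
have [f fP] := SL_action.
have f_compat g s : g \in SL 2 F -> compat g s -> f g = s.
  by move=> SLg; apply: compat_uniq; apply: fP.
have sGf : G \subset f @* SL 2 F.
  rewrite gen_subG; apply/subsetP=> s; rewrite in_set2 => /orP[] /eqP->.
    have SLlow : low (1 : F) \in SL 2 F by rewrite inE det_mx2 mulr1 mul0r subr0.
    by rewrite -[X in X \in _](f_compat (low (1 : F)) _ _ compat_low) ?mem_morphim.
  have SLupp : upp (3 : F) \in SL 2 F by rewrite inE det_mx2 mulr1 mulr0 subr0.
  by rewrite -[X in X \in _](f_compat (upp (3 : F)) _ _ compat_upp) ?mem_morphim.
have sZker : 'Z(SL 2 F) \subset 'ker f.
  rewrite center_SL2; apply/subsetP=> g; rewrite in_set2 => /orP[] /eqP->; first exact: group1.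
  have SLo : opp1 F \in SL 2 F by rewrite inE det_mx2 mulrNN mulr1 mul0r subr0.
  by apply/kerP => //; apply: f_compat; last exact: compat_opp1.
have F2 : (2%:R : F) != 0 by [].
have cardPSL : #|PSL 2 F| = 168%N.
  by apply/eqP; rewrite -(eqn_pmul2r (isT : (0 < 2)%N)) card_PSL2 // card_Fp.
have ker_im : (#|'ker f| * #|f @* SL 2 F| = 336)%N.
  rewrite -card_SL -(card_isog (first_isog f)) card_quotient ?ker_norm //.
  by rewrite Lagrange // subsetIl.
have eqZ : 'Z(SL 2 F) = 'ker f.
  apply/eqP; rewrite eqEcard sZker (card_center_SL2 F2) -(leq_pmul2r (isT : (0 < 168)%N)).
  rewrite (leq_trans _ (eq_leq ker_im)) // leq_mul // -cardG.
  exact: subset_leq_card.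
have eqG : G :=: f @* SL 2 F.
  apply/eqP; rewrite eqEcard sGf cardG -(leq_pmul2l (isT : (0 < 2)%N)).
  rewrite -[X in (X * _ <= _)%N](card_center_SL2 F2) eqZ.
  by rewrite ker_im.
have quo (N : {group {'GL_2[F]}}) : N :=: 'ker f -> SL_group 2 F / N \isog f @* SL 2 F.
  by move=> eqN; have -> : N = ('ker f)%G; [apply: group_inj | apply: first_isog].
by split=> //; rewrite isog_sym -/G eqG; apply: quo ('Z(SL 2 F))%G eqZ.
Qed.

End PSLiso.

(** * Classification *)

(** In normal form the second entry is a power [c ^ a] of the rotation [c]. Conjugation by [c] fixes
    it, so the classes correspond to the exponents counted by [unit_pairs]. *)
Lemma card_cyclic_classes n :
  #|iso_classes [set t : perm_triple n.+1 |
      [&& is_belyi t, passport t == ([:: n.+1], [:: n.+1], [:: n.+1])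
        & monodromy t \isog Zp n.+1]]| = prod_formula n.+1.
Proof.
rewrite -size_unit_pairs // -(size_map (fun a => rot_perm n ^+ a)).
have unit_full a :
  (std_triple (rot_perm n ^+ a) \in full_triples n) = unit_pair n.+1 a.
  by rewrite std_full_triples -expgS !full_cycle_rotX /unit_pair coprimeMr.
have -> : [set t : perm_triple n.+1 | [&& is_belyi t,
    passport t == ([:: n.+1], [:: n.+1], [:: n.+1]) & monodromy t \isog Zp n.+1]]
  = [set t in full_triples n | monodromy t \isog Zp n.+1].
  by apply/setP=> t; rewrite 2!inE andbA passport_full inE.
apply: card_iso_classes; first exact: isog_monodromy_invariant.
- rewrite map_inj_in_uniq ?filter_uniq ?iota_uniq // => a b.
  rewrite !mem_filter !mem_iota /= => /andP[_ lta] /andP[_ ltb].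
  move/(congr1 (fun s : {perm 'I_n.+1} => val (s ord0))).
  by rewrite /= !rot_permX !add0n !modn_small.
- move=> _ /mapP[a + ->]; rewrite mem_filter => /andP[ua _].
  by rewrite unit_full monodromy_std_cyclic cycle_rot_isog.
(* The monodromy group has order [n + 1] and contains the rotation, which therefore generates it. *)
- move=> s Fs iso_s; have cyc_s : monodromy (std_triple s) :=: <[rot_perm n]>.
    apply/esym/eqP; rewrite eqEcard cycle_subG mem_gen ?inE ?eqxx //=.
    by rewrite (card_isog iso_s) card_Zp // -orderE order_rot_perm.
  have : s \in <[rot_perm n]> by rewrite -cyc_s mem_gen // !inE eqxx orbT.
  case/cycleP=> k def_s; have [|a lta def_a] := @cent_rot_perm n s.
    by rewrite def_s; apply: commuteX.
  exists 0%N; rewrite expg0 conjg1 def_a map_f // mem_filter.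
  by rewrite -unit_full -def_a Fs mem_iota.
move=> _ _ /mapP[a _ ->] /mapP[b _ ->] k _ <-.
by apply/esym/conjg_fixP/commgP; apply: commuteX2.
Qed.

Lemma cyclic_map_invariant d : conj_invariant (@cyclic_map d).
Proof. by move=> t w; rewrite /cyclic_map monodromyJ cyclicJ. Qed.

Lemma conj_rep n (r : seq (seq nat)) (t : perm_triple n.+1) :
    reps_ok n.+1 r -> t \in full_triples n ->
  exists2 a, a \in r & exists w, t = conj_triple (std_triple (decode n a)) w.
Proof.
case/and4P=> _ /allP r_ok _ /allP r_cover Ft.
have [s [w def_t]] := full_triples_std Ft.
have := r_cover (code s); rewrite mem_permutations perm_code lfull_code.
move: Ft; rewrite def_t full_triplesJ => -> /(_ isT)/hasP[a ra].
have /decodeK aK : perm_eq a (iota 0 n.+1) by have /andP[] := r_ok a ra.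
rewrite -{1}aK => /lconj_code[k _ def_a]; exists a => //; exists (rot_perm n ^- k * w).
by rewrite -def_a -std_triple_conj /conj_triple /= !conjgM !conjgK.
Qed.

Lemma count_constant (T : eqType) (P : pred T) (r : seq T) (b : bool) :
  {in r, forall x, P x = b} -> count P r = (b * size r)%N.
Proof.
move=> Pb; rewrite (eq_in_count (a2 := fun=> b)) //.
by case: b {Pb}; rewrite ?mul1n ?count_predT ?count_pred0.
Qed.

Lemma cyclic_rep_isog n a : a \in cyclic_reps n.+1 ->
  monodromy (std_triple (decode n a)) \isog Zp n.+1.
Proof.
case/mapP=> k _ ->; rewrite -code_rotX codeK monodromy_std_cyclic; exact: cycle_rot_isog.
Qed.

Lemma alt_rep_monodromy n certs a : prime n.+1 -> ~~ odd n ->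
    all (alt_cert n.+1) certs -> a \in [seq cert.1.1 | cert <- certs] ->
  monodromy (std_triple (decode n a)) :=: 'Alt_('I_n.+1).
Proof.
move=> n_pr n_even /allP certs_ok /mapP[cert /certs_ok cert_ok ->].
exact: monodromy_alt_cert.
Qed.

Definition neg_perm : {perm 'I_7} := decode 6 [:: 0; 6; 5; 4; 3; 2; 1]%N.

(** Conjugation by [i -> - i] sends both generators to the inverses of the generators of the other
    group. *)
Lemma monodromy_psl' :
  monodromy (std_triple (decode 6 psl_rep')) :^ neg_perm = monodromy (std_triple psl_gen).
Proof.
have negE (s t : {perm 'I_7}) :
    lmul (lmul (code s) [:: 0; 6; 5; 4; 3; 2; 1]%N) (code t) = [:: 0; 6; 5; 4; 3; 2; 1]%N ->
  s ^ neg_perm = t^-1.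
  rewrite -(@decodeK 6 [:: 0; 6; 5; 4; 3; 2; 1]%N) // -/neg_perm -!codeM => /code_inj st.
  by apply: (mulIg t); rewrite mulVg conjgE -!mulgA (mulgA s) st mulVg.
rewrite -monodromyJ /monodromy /conj_triple /sigma0 /sigma1 /=.
rewrite (negE (rot_perm 6) (rot_perm 6)) ?code_rot //.
rewrite (negE (decode 6 psl_rep') psl_gen) ?decodeK //.
apply/eqP; rewrite eqEsubset !gen_subG !subUset !sub1set; apply/andP; split.
  by rewrite !groupV !mem_gen ?inE ?eqxx ?orbT.
by rewrite -(groupV _ (rot_perm 6)) -(groupV _ psl_gen) !mem_gen ?inE ?eqxx ?orbT.
Qed.

Lemma psl_rep_monodromy a : a \in [:: psl_rep; psl_rep'] ->
  monodromy (std_triple (decode 6 a)) \isog PSL 2 'F_7 /\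
  acts_as_on_Fano_plane (monodromy (std_triple (decode 6 a))).
Proof.
have [iso_psl card_psl _ fano_psl] := psl_monodromy.
have fano : acts_as_on_Fano_plane (monodromy (std_triple psl_gen)).
  by apply: acts_as_on_Fano_plane_fano_group; rewrite ?card_psl.
rewrite in_cons mem_seq1 => /orP[] /eqP->; first by split.
have -> : monodromy (std_triple (decode 6 psl_rep'))
    :=: monodromy (std_triple psl_gen) :^ neg_perm^-1.
  by rewrite -monodromy_psl' conjsgK.
split; last exact: acts_as_on_Fano_planeJ.
by apply: isog_trans iso_psl; rewrite isog_sym conj_isog.
Qed.

(** Carried over to the monodromy group, where the two generators do not commute. *)
Lemma PSL_noncyclic : ~~ cyclic (PSL 2 'F_7).
Proof.
have [iso_psl _ _ _] := psl_monodromy; rewrite -(isog_cyclic iso_psl).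
apply/negP=> /cyclic_abelian/centsP abel.
have : commute (rot_perm 6) psl_gen by apply: abel; rewrite mem_gen // !inE eqxx ?orbT.
by move/(congr1 (@code 6)); rewrite !codeM code_rot decodeK.
Qed.

Lemma Alt_noncyclic n : 4 < n -> ~~ cyclic 'Alt_('I_n).
Proof.
move=> n_gt4; apply/negP=> /cyclic_abelian/abelian_sol.
by rewrite solvable_AltF // card_ord.
Qed.

(** Here and in genus 2 and 3, a property with a constant truth value on each monodromy type is
    counted by adding the sizes of the families where it holds; all counts of extremal maps are
    instances. *)
Lemma genus1_classes (P : pred (perm_triple 3)) (bc : bool) :
    conj_invariant P -> (forall t, monodromy t \isog Zp 3 -> P t = bc) ->
  #|iso_classes [set t in extremal_maps 1 | P t]| = bc.
Proof.
move=> invP Pc; rewrite extremal_mapsE (count_iso_classes_code reps3_ok invP).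
rewrite (@count_constant _ _ _ bc) ?muln1 // => a /cyclic_rep_isog.
exact: Pc.
Qed.

Lemma genus2_classes (P : pred (perm_triple 5)) (bc ba : bool) :
    conj_invariant P -> (forall t, monodromy t \isog Zp 5 -> P t = bc) ->
    (forall t, monodromy t :=: 'Alt_('I_5) -> P t = ba) ->
  #|iso_classes [set t in extremal_maps 2 | P t]| = (bc * 3 + ba)%N.
Proof.
move=> invP Pc Pa; rewrite extremal_mapsE (count_iso_classes_code reps5_ok invP).
rewrite count_cat (@count_constant _ _ (cyclic_reps 5) bc); last first.
  by move=> a /cyclic_rep_isog; apply: Pc.
rewrite (@count_constant _ _ [seq c.1.1 | c <- alt_reps5] ba) ?muln1 // => a ra.
by apply: Pa; apply: alt_rep_monodromy alt_reps5_ok ra.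
Qed.

Lemma genus3_classes (P : pred (perm_triple 7)) (bc bp ba : bool) :
    conj_invariant P -> (forall t, monodromy t \isog Zp 7 -> P t = bc) ->
    (forall t, monodromy t \isog PSL 2 'F_7 -> P t = bp) ->
    (forall t, monodromy t :=: 'Alt_('I_7) -> P t = ba) ->
  #|iso_classes [set t in extremal_maps 3 | P t]| = (bc * 5 + bp * 2 + ba * 23)%N.
Proof.
move=> invP Pc Pp Pa; rewrite extremal_mapsE (count_iso_classes_code reps7_ok invP).
rewrite !count_cat addnA (@count_constant _ _ (cyclic_reps 7) bc); last first.
  by move=> a /cyclic_rep_isog; apply: Pc.
rewrite (@count_constant _ _ [:: psl_rep; psl_rep'] bp); last first.
  by move=> a /psl_rep_monodromy[+ _]; apply: Pp.
rewrite (@count_constant _ _ [seq c.1.1 | c <- alt_reps7] ba) // => a ra.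
by apply: Pa; apply: alt_rep_monodromy alt_reps7_ok ra.
Qed.

Lemma genus1_monodromy t : t \in extremal_maps 1 -> monodromy t \isog Zp 3.
Proof.
rewrite extremal_mapsE => /(conj_rep reps3_ok)[a ra [w ->]].
by rewrite (isog_monodromy_invariant (Zp_group 3)); apply: cyclic_rep_isog.
Qed.

Lemma genus2_monodromy t : t \in extremal_maps 2 ->
  monodromy t \isog Zp 5 \/ monodromy t :=: 'Alt_('I_5).
Proof.
rewrite extremal_mapsE => /(conj_rep reps5_ok)[a + [w ->]].
rewrite mem_cat => /orP[/cyclic_rep_isog|/(@alt_rep_monodromy 4 _ _ isT isT alt_reps5_ok)] mono_a.
  by left; rewrite (isog_monodromy_invariant (Zp_group 5)).
by right; apply/eqP; rewrite Alt_monodromy_invariant; apply/eqP.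
Qed.

Lemma genus3_monodromy t : t \in extremal_maps 3 ->
  [\/ monodromy t \isog Zp 7,
      monodromy t \isog PSL 2 'F_7 /\ acts_as_on_Fano_plane (monodromy t)
    | monodromy t :=: 'Alt_('I_7)].
Proof.
rewrite extremal_mapsE => /(conj_rep reps7_ok)[a + [w ->]].
rewrite !mem_cat => /or3P[/cyclic_rep_isog|/psl_rep_monodromy[]|
    /(@alt_rep_monodromy 6 _ _ isT isT alt_reps7_ok)] mono_a.
- by constructor 1; rewrite (isog_monodromy_invariant (Zp_group 7)).
- move=> fano_a; constructor 2; rewrite (isog_monodromy_invariant (PSL_group 2 _)).
  by split=> //; rewrite monodromyJ; apply: acts_as_on_Fano_planeJ.
by constructor 3; apply/eqP; rewrite Alt_monodromy_invariant; apply/eqP.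
Qed.

Lemma isog_Zp_cyclic (gT : finGroupType) (G : {group gT}) n : G \isog Zp n.+1 -> cyclic G.
Proof. by move/isog_cyclic->; rewrite -(isog_cyclic (cycle_rot_isog n)) cycle_cyclic. Qed.

Lemma card_PSL2_7 : #|PSL 2 'F_7| = 168. Proof. by have [] := psl_monodromy. Qed.

Lemma card_Alt7_neq : #|'Alt_('I_7)| != 168.
Proof.
apply/eqP=> e; have := @card_Alt 'I_7; rewrite e card_ord => /(_ isT)/eqP.
by [].
Qed.

(** One representative of each type is exhibited. Orders separate PSL_2(F_7) from the other two
    groups, and cyclicity separates Z/7 from A_7. *)
Lemma genus3_monodromy_groups :
  #|equivalence_partition
      (fun t u : perm_triple 7 => monodromy t \isog monodromy u) (extremal_maps 3)| = 3.
Proof.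
have full a : perm_eq a (iota 0 7) && lfull 7 a ->
    std_triple (decode 6 a) \in extremal_maps 3.
  by case/andP=> /decodeK aK; rewrite extremal_mapsE -{1}aK lfull_code.
have [tZ extZ monoZ] : exists2 t, t \in extremal_maps 3 & monodromy t \isog Zp 7.
  exists (std_triple (decode 6 (lrot 7 1))); first by apply: full; lazy.
  by apply: cyclic_rep_isog; apply: mem_head.
have [tP extP monoP] : exists2 t, t \in extremal_maps 3 & monodromy t \isog PSL 2 'F_7.
  exists (std_triple (decode 6 psl_rep)); first by apply: full; lazy.
  by have [] := psl_rep_monodromy (mem_head _ [:: psl_rep']).
have [tA extA monoA] : exists2 t, t \in extremal_maps 3 & monodromy t :=: 'Alt_('I_7).
  exists (std_triple (decode 6 (nth [::] [seq c.1.1 | c <- alt_reps7] 0))).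
    by apply: full; lazy.
  by apply: (@alt_rep_monodromy 6 _ _ isT isT alt_reps7_ok); apply: mem_head.
have ZP : (monodromy tZ \isog monodromy tP) = false.
  by apply/idP => /card_isog; rewrite (card_isog monoZ) (card_isog monoP) card_PSL2_7 card_Zp.
have PA : (monodromy tP \isog monodromy tA) = false.
  apply/idP => /card_isog; rewrite (card_isog monoP) monoA card_PSL2_7 => cA.
  by have := card_Alt7_neq; rewrite -cA.
have ZA : (monodromy tZ \isog monodromy tA) = false.
  apply/idP => /isog_cyclic; rewrite (isog_Zp_cyclic monoZ) monoA.
  by rewrite (negbTE (Alt_noncyclic _)).
have PZ := ZP; rewrite isog_sym in PZ; have AP := PA; rewrite isog_sym in AP.
have AZ := ZA; rewrite isog_sym in AZ.
apply: (@card_partition_reps _ _ _ [:: tZ; tP; tA]).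
- move=> t u v _ _ _; split=> [|tu]; first exact: isog_refl.
  apply/idP/idP; last exact: isog_trans.
  by apply: isog_trans; rewrite isog_sym.
- rewrite /= !inE !negb_or andbT -andbA; apply/and3P.
  by split; apply/eqP => e; [move: ZP | move: ZA | move: PA]; rewrite e isog_refl.
- by move=> t; rewrite in_cons in_cons mem_seq1 => /or3P[] /eqP->.
- move=> t /genus3_monodromy[tG | [tG _] | tG] /=.
  + by rewrite (isog_trans tG) // isog_sym.
  + by rewrite (isog_trans tG (_ : _ \isog monodromy tP)) ?orbT // isog_sym.
  + by rewrite tG -monoA isog_refl !orbT.
by move=> t u; rewrite !inE => /or3P[] /eqP-> /or3P[] /eqP->; rewrite ?ZP ?PA ?ZA ?PZ ?AP ?AZ.
Qed.

(** Puts the total counts in the form expected by the counting lemmas, with the property that always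
    holds. *)
Lemma iso_classesT d (D : {set perm_triple d}) :
  #|iso_classes D| = #|iso_classes [set t in D | predT t]|.
Proof. by congr #|iso_classes _|; apply/setP=> t; rewrite inE andbT. Qed.

Theorem theorem8p6 :
  (* g = 1, d = 3 *)
  [/\ #|iso_classes (extremal_maps 1)| = 1%N,
      #|iso_classes [set t in extremal_maps 1 | monodromy t \isog Zp 3]| = 1%N
    & forall t, t \in extremal_maps 1 -> cyclic_map t]
  /\ (* g = 2, d = 5 *)
  [/\ #|iso_classes (extremal_maps 2)| = 4%N,
      #|iso_classes [set t in extremal_maps 2 | monodromy t \isog Zp 5]| = 3%N
    & #|iso_classes [set t in extremal_maps 2 | monodromy t :==: 'Alt_('I_5)]|
      = 1%N]
  /\ (* g = 3, d = 7 *)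
  [/\ #|iso_classes (extremal_maps 3)| = 30%N,
      #|iso_classes [set t in extremal_maps 3 | monodromy t \isog Zp 7]| = 5%N,
      #|iso_classes [set t in extremal_maps 3 | monodromy t \isog PSL 2 'F_7]|
      = 2%N
    & #|iso_classes [set t in extremal_maps 3 | monodromy t :==: 'Alt_('I_7)]|
      = 23%N]
  /\ (* (i) *)
  [/\ forall d : nat, odd d -> 3 <= d ->
        #|iso_classes [set t : perm_triple d |
            [&& is_belyi t, passport t == ([:: d], [:: d], [:: d])
              & monodromy t \isog Zp d]]| = prod_formula d,
      #|iso_classes [set t in extremal_maps 1 | cyclic_map t]| = 1%N
        /\ prod_formula 3 = 1%N,
      #|iso_classes [set t in extremal_maps 2 | cyclic_map t]| = 3%N
        /\ prod_formula 5 = 3%N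
    & #|iso_classes [set t in extremal_maps 3 | cyclic_map t]| = 5%N
        /\ prod_formula 7 = 5%N]
  /\ (* (ii) *)
  (#|iso_classes [set t in extremal_maps 2 | ~~ cyclic_map t]| = 1%N
   /\ forall t, t \in extremal_maps 2 -> ~~ cyclic_map t ->
        monodromy t :=: 'Alt_('I_5))
  /\ (* (iii) *)
  [/\ #|equivalence_partition
          (fun t u : perm_triple 7 => monodromy t \isog monodromy u)
          (extremal_maps 3)| = 3%N,
      #|PSL 2 'F_7| = 168%N
    & forall t, t \in extremal_maps 3 -> monodromy t \isog PSL 2 'F_7 ->
        acts_as_on_Fano_plane (monodromy t)].
Proof.
have ncA5 : ~~ cyclic 'Alt_('I_5) by apply: Alt_noncyclic.
have ncA7 : ~~ cyclic 'Alt_('I_7) by apply: Alt_noncyclic.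
have isoZ d := isog_monodromy_invariant (d := d) (Zp_group d).
have isoP := isog_monodromy_invariant (d := 7) (PSL_group 2 'F_7).
have neqA d (t : perm_triple d) (G : {group {perm 'I_d}}) : cyclic (monodromy t) ->
    ~~ cyclic G -> (monodromy t :==: G) = false.
  by move=> cyc_t ncG; apply: contraNF ncG => /eqP <-.
have nZp d (gT : finGroupType) (G : {group gT}) : ~~ cyclic G -> (G \isog Zp d.+1) = false.
  by apply: contraNF => /isog_Zp_cyclic.
have ncP (gT : finGroupType) (G : {group gT}) : G \isog PSL 2 'F_7 -> ~~ cyclic G.
  by move/isog_cyclic->; apply: PSL_noncyclic.
have nPA (t : perm_triple 7) : monodromy t \isog PSL 2 'F_7 -> monodromy t :!=: 'Alt_('I_7).
  move/card_isog => cP; apply/eqP=> tA; have := card_Alt7_neq.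
  by rewrite -tA cP card_PSL2_7 eqxx.
split; first split.
- by rewrite iso_classesT (@genus1_classes _ true).
- by rewrite (@genus1_classes _ true) //; apply: isoZ.
- by move=> t /genus1_monodromy iso_t; apply: isog_Zp_cyclic iso_t.
split; first split.
- by rewrite iso_classesT (@genus2_classes _ true true).
- rewrite (@genus2_classes _ true false) // => [|t tA]; first exact: isoZ.
  by rewrite nZp // tA.
- rewrite (@genus2_classes _ false true) // => [|t tZ|t tA].
  + exact: Alt_monodromy_invariant.
  + by apply: neqA => //; apply: isog_Zp_cyclic tZ.
  + by rewrite tA eqxx.
split; first split.
- by rewrite iso_classesT (@genus3_classes _ true true true).
(* The Booleans are the truth values on cyclic, PSL_2(F_7) and alternating monodromy, in this
   order. *)
- rewrite (@genus3_classes _ true false false) // => [|t tG|t tG]; first exact: isoZ.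
    by rewrite nZp ?ncP.
  by rewrite nZp // tG.
- rewrite (@genus3_classes _ false true false) // => t tG.
    by apply: contraTF (isog_Zp_cyclic tG); apply: ncP.
  by apply/idP => tP; have := nPA t tP; rewrite tG eqxx.
- rewrite (@genus3_classes _ false false true) // => [|t tZ|t tP|t tA].
  + exact: Alt_monodromy_invariant.
  + by apply: neqA => //; apply: isog_Zp_cyclic tZ.
  + by apply/negbTE/nPA.
  + by rewrite tA eqxx.
split; first split.
- by case=> // n _ _; apply: card_cyclic_classes.
- split; last by rewrite /prod_formula big_seq1.
  rewrite (@genus1_classes _ true) // => [|t]; first exact: cyclic_map_invariant.
  exact: isog_Zp_cyclic.
- split; last by rewrite /prod_formula big_seq1.
  rewrite (@genus2_classes _ true false) // => [|t|t tA]; first exact: cyclic_map_invariant.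
    exact: isog_Zp_cyclic.
  by rewrite /cyclic_map tA; apply/negbTE.
- split; last by rewrite /prod_formula big_seq1.
  rewrite (@genus3_classes _ true false false) // => [|t|t tP|t tA].
  + exact: cyclic_map_invariant.
  + exact: isog_Zp_cyclic.
  + by apply/negbTE/ncP.
  + by rewrite /cyclic_map tA; apply/negbTE.
split; first split.
- rewrite (@genus2_classes (fun t => ~~ cyclic_map t) false true) // => [t w|t|t tA].
  + by rewrite cyclic_map_invariant.
  + by move/isog_Zp_cyclic; rewrite /cyclic_map => ->.
  + by rewrite /cyclic_map tA.
- by move=> t /genus2_monodromy[/isog_Zp_cyclic|//]; rewrite /cyclic_map => ->.
split.
- exact: genus3_monodromy_groups.
- exact: card_PSL2_7.
(* The cyclic case contradicts noncyclicity of PSL_2(F_7), and the alternating case its order. *)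
- move=> t /genus3_monodromy[/isog_Zp_cyclic tZ tP | [] // | tA tP].
    by have := ncP _ _ tP; rewrite tZ.
  by have := nPA t tP; rewrite tA eqxx.
Qed.
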